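(* Let $n\ge1$, $0<\delta<1$ and $q=k+\alpha$ with $k\in\mathbb N$ and $\alpha\in(0,1)$. There is a constant $C(n,q,\delta)$ such that the following holds. Suppose $f\in\mathcal U^{q,\delta}(B_1)$ and $u$ is a bounded solution of $\triangle u=f$ on $B_1\subset\mathbb R^n$. Then $u\in\mathcal U^{q+2,\delta}(B_{1-\delta})$ and $$\|u\|_{\mathcal U^{q+2,\delta}(B_{1-\delta})}\le C(n,q,\delta)\left(\|f\|_{\mathcal U^{q,\delta}(B_1)}+\|u\|_{C^0(B_1)}\right).$$
   Context: $B_r$ is the open ball of radius $r$ centered at the origin in $\mathbb R^n$ and $\triangle$ is the Euclidean Laplacian. Uniformly bounded expansion: let $r,\delta>0$ and $q>0$. A function $u$ defined on $B_{r+\delta}$ has uniformly bounded expansion up to order $q$ on $B_r$ with scale $\delta$ if there is $\Lambda>0$ such that for every $x\in B_r$ there is a polynomial $p_x(h)$ of degree smaller than $q$, whose coefficients (depending on $x$) are bounded in absolute value by $\Lambda$, with $$|u(x+h)-p_x(h)|\le\Lambda|h|^q\qquad\text{for all }|h|<\delta.$$ The set of such functions is denoted $\mathcal U^{q,\delta}(B_r)$, and $\|u\|_{\mathcal U^{q,\delta}(B_r)}$ is the infimum of all such $\Lambda$. *)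

(* Defs.v *)
From mathcomp Require Import all_boot all_order all_algebra.
From mathcomp Require Import all_classical all_reals all_analysis.
(* The notations of mpoly clash with those of MathComp-Analysis. *)
From mathcomp Require Import -(notations) mpoly.
Import Order.TTheory GRing.Theory Num.Theory.
Import numFieldNormedType.Exports.

Set Implicit Arguments.
Unset Strict Implicit.
Unset Printing Implicit Defensive.

Local Open Scope classical_set_scope.
Local Open Scope ring_scope.

(* The library norm `|x| on row vectors is the sup norm, hence this one. *)
Definition euclid_norm (R : realType) (n : nat) (x : 'rV[R]_n) : R :=
  Num.sqrt (\sum_(i < n) x ord0 i ^+ 2).

Definition euclid_ball (R : realType) (n : nat) (r : R) : set 'rV[R]_n :=
  [set x | euclid_norm x < r].

Definition degree_lt (R : realType) (n : nat) (q : R) (p : mpoly n R) :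
    Prop :=
  forall m : multinom n, m \in msupp p -> (mdeg m)%:R < q.

(* Functions on B_(r + delta) are represented by total functions; only their
   values on B_(r + delta) occur.  Note that 0 `^ q = 0 for q > 0, so h = 0
   gives u x = p_x(0). *)
Definition has_expansion_bound (R : realType) (n : nat) (q delta r : R)
    (u : 'rV[R]_n -> R) (L : R) : Prop :=
  0 < L /\
  forall x, euclid_ball r x ->
    exists p : mpoly n R,
      [/\ degree_lt q p,
          forall m : multinom n, `|mcoeff m p| <= L
        & forall h : 'rV[R]_n, euclid_norm h < delta ->
            `|u (x + h) - meval (fun i => h ord0 i) p|
              <= L * euclid_norm h `^ q].

Definition bounded_expansion (R : realType) (n : nat) (q delta r : R)
    (u : 'rV[R]_n -> R) : Prop :=
  exists L, has_expansion_bound q delta r u L.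

Definition expansion_norm (R : realType) (n : nat) (q delta r : R)
    (u : 'rV[R]_n -> R) : R :=
  inf [set L | has_expansion_bound q delta r u L].

Definition C0_norm (R : realType) (n : nat) (A : set 'rV[R]_n)
    (u : 'rV[R]_n -> R) : R :=
  sup [set `|u x| | x in A].

Definition partial (R : realType) (n : nat) (i : 'I_n) (u : 'rV[R]_n -> R) :
    'rV[R]_n -> R :=
  fun x => derive u x (delta_mx ord0 i).

Definition laplacian (R : realType) (n : nat) (u : 'rV[R]_n -> R) :
    'rV[R]_n -> R :=
  fun x => \sum_(i < n) partial i (partial i u) x.

(* Meant for open A, so that derivatives at points of A only depend on the
   restriction of u to A. *)
Definition C1_on (R : realType) (n : nat) (A : set 'rV[R]_n)
    (u : 'rV[R]_n -> R) : Prop :=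
  forall x, A x -> forall i : 'I_n,
    derivable u x (delta_mx ord0 i) /\ {for x, continuous (partial i u)}.

Definition C2_on (R : realType) (n : nat) (A : set 'rV[R]_n)
    (u : 'rV[R]_n -> R) : Prop :=
  C1_on A u /\ forall i : 'I_n, C1_on A (partial i u).

Definition poisson_solution (R : realType) (n : nat) (A : set 'rV[R]_n)
    (f u : 'rV[R]_n -> R) : Prop :=
  C2_on A u /\ forall x, A x -> laplacian u x = f x.

(* Main.v *)
Require Import Defs.
From mathcomp Require Import all_boot all_order all_algebra.
From mathcomp Require Import all_classical all_reals all_analysis.
From mathcomp Require Import ring lra.
From mathcomp Require Import -(notations) mpoly.
Import Order.TTheory GRing.Theory Num.Theory.
Import numFieldNormedType.Exports.

(* Around a point x, subtract from u a polynomial Q with Laplacian p_x: what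
   remains is a bounded v with |lap v (h)| <= L |h|^q.  On the ball of radius
   r, v is within O(r^(q+2)) of a harmonic polynomial: approximate v on the
   sphere by a polynomial (Weierstrass), solve the Dirichlet problem with this
   polynomial datum inside the polynomials, and apply the maximum principle.
   Bernstein's gradient estimate bounds the coefficients and the Taylor
   remainders of a harmonic polynomial by its supremum, with constants that do
   not depend on its degree.  Hence, along the radii r_j = 2^-j r_0, the
   coefficients of degree m <= k + 2 of consecutive approximants differ by
   O(r_j^(q+2-m)) and converge geometrically to those of the required
   expansion, while the remainders of degree k + 3 > q + 2 sum up to
   O(r_J^(q+2)). *)

Set Implicit Arguments.
Unset Strict Implicit.
Unset Printing Implicit Defensive.

Local Open Scope classical_set_scope.
Local Open Scope ring_scope.

(** With polynomials as approximants, Taylor expansion is splitting by degree, differentiation is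
    formal, and solvability of the Dirichlet problem is deduced from uniqueness by a dimension
    count. The maximum principle remains the main analytic tool; it is phrased with symmetric second
    differences so that it applies to the difference of a C^2 function and a polynomial. The
    condition 0 < alpha < 1 decides the geometric sums. With tau = 2^-(q+2), the ratio tau 2^m is at
    most 2^-alpha < 1 for m <= k + 2 and equals 2^(1-alpha) > 1 for m = k + 3: coefficients
    converge, and the sum of the remainders is governed by its last term. An integer q would produce
    a ratio equal to 1. *)

Local Notation ev p x := (meval (fun i => x ord0 i) p).
Local Notation "''x_' i" := (mpolyX _ (mnm1 i)) (at level 8, i at level 2).
Local Notation e_ i := (delta_mx ord0 i).

(** * Polynomials on lines, formal Laplacian, symmetric second differences *)

Section Polynomials.
Variables (R : realType) (n : nat).
Implicit Types (p q : mpoly n R) (x y a b : 'rV[R]_n).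

Lemma mnm1_subK i : mnm_sub (mnm1 i) (mnm1 i) = mnm0 :> multinom n.
Proof. by rewrite -[X in mnm_sub X _]add0m addmK. Qed.

Lemma mpoly_ring_ind (P : mpoly n R -> Prop) :
  (forall c, P (mpolyC n c)) -> (forall i, P 'x_i) ->
  (forall p q, P p -> P q -> P (p + q)) ->
  (forall p q, P p -> P q -> P (p * q)) -> forall p, P p.
Proof.
move=> PC PX PD PM.
have PXm m : P (mpolyX R m).
  rewrite mpolyXE_id; elim/big_ind : _ => //; first exact: (PC 1).
  move=> i _; elim: (m i) => [|k IH]; first by rewrite expr0; exact: (PC 1).
  by rewrite exprS; exact: PM.
apply: mpolyind => [|c m p _ _ Pp]; first by rewrite -(mpolyC0 n R); exact: PC.
by apply: PD => //; rewrite -mul_mpolyC; exact: PM.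
Qed.

(** The restriction of [p] to the line t |-> a + t b, as a univariate polynomial: one-variable
    calculus then applies to [p], with a formal chain rule. *)
Definition line a b p : {poly R} :=
  mmap (@polyC R) (fun i => (a ord0 i)%:P + b ord0 i *: 'X) p.

Lemma horner_line a b p t : (line a b p).[t] = ev p (a + t *: b).
Proof.
elim/mpoly_ring_ind: p => [c|i|p q Hp Hq|p q Hp Hq].
- by rewrite /line mmapC hornerC mevalC.
- by rewrite /line mmapX mmap1U mevalXU !hornerE !mxE mulrC.
- by rewrite /line mmapD hornerD Hp Hq mevalD.
- by rewrite /line rmorphM hornerM Hp Hq mevalM.
Qed.

Lemma deriv_line a b p :
  (line a b p)^`() = \sum_i b ord0 i *: line a b (mderiv i p).
Proof.
elim/mpoly_ring_ind: p => [c|i|p q Hp Hq|p q Hp Hq].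
- rewrite /line mmapC derivC big1 // => i _.
  by rewrite mderivC mmap0 scaler0.
- rewrite /line mmapX mmap1U derivD derivC add0r derivZ derivX.
  rewrite (bigD1 i)//= big1 ?addr0.
    rewrite mderivX mnm1E eqxx mnm1_subK mpolyX0 scale1r.
    by rewrite -[1 in RHS]mpolyC1 mmapC.
  move=> j ji; rewrite mderivX mnm1E eq_sym (negbTE ji) scale0r.
  by rewrite mmap0 scaler0.
- rewrite /line mmapD derivD Hp Hq -big_split; apply: eq_bigr => i _ /=.
  by rewrite mderivD mmapD scalerDr.
- rewrite {1}/line rmorphM derivM Hp Hq mulr_suml mulr_sumr -big_split.
  apply: eq_bigr => i _ /=.
  by rewrite mderivM /line rmorphD !rmorphM/= scalerDr scalerAl scalerAr.
Qed.

Lemma continuous_ev p : continuous (fun x => ev p x).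
Proof.
elim/mpoly_ring_ind: p => [c|i|p q Hp Hq|p q Hp Hq].
- have -> : (fun x : 'rV[R]_n => ev (mpolyC n c) x) = cst c.
    by apply/funext=> y; rewrite mevalC.
  exact: cst_continuous.
- have -> : (fun x : 'rV[R]_n => ev 'x_i x) = fun x => x ord0 i.
    by apply/funext=> y; rewrite mevalXU.
  exact: coord_continuous.
- have -> : (fun x => ev (p + q) x) = (fun x => ev p x) \+ (fun x => ev q x).
    by apply/funext=> y; rewrite mevalD.
  by move=> x; exact: cvgD (Hp x) (Hq x).
- have -> : (fun x => ev (p * q) x) = (fun x => ev p x) \* (fun x => ev q x).
    by apply/funext=> y; rewrite mevalM.
  by move=> x; exact: cvgM (Hp x) (Hq x).
Qed.

Definition mlap p : mpoly n R := \sum_i mderiv i (mderiv i p).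

Lemma mlapD p q : mlap (p + q) = mlap p + mlap q.
Proof. by rewrite /mlap -big_split; apply: eq_bigr => i _; rewrite !mderivD. Qed.

Lemma mlapZ c p : mlap (c *: p) = c *: mlap p.
Proof. by rewrite /mlap scaler_sumr; apply: eq_bigr => i _; rewrite !mderivZ. Qed.

Lemma mlapN p : mlap (- p) = - mlap p.
Proof. by rewrite -scaleN1r mlapZ scaleN1r. Qed.

Lemma mlapB p q : mlap (p - q) = mlap p - mlap q.
Proof. by rewrite mlapD mlapN. Qed.

Lemma mlap0 : mlap 0 = 0.
Proof. by have := mlapZ 0 0; rewrite !scale0r. Qed.

Lemma mlapC c : mlap (mpolyC n c) = 0.
Proof. by rewrite /mlap big1 // => i _; rewrite mderivC mderiv0. Qed.

Lemma mlap_mderiv j p : mlap (mderiv j p) = mderiv j (mlap p).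
Proof.
rewrite /mlap raddf_sum; apply: eq_bigr => i _ /=.
by rewrite (mderiv_comm j i p) (mderiv_comm j i).
Qed.

Lemma mlapM p q : mlap (p * q) =
  mlap p * q + (\sum_i mderiv i p * mderiv i q) *+ 2 + p * mlap q.
Proof.
rewrite /mlap mulr_suml mulr_sumr -sumrMnl -!big_split; apply: eq_bigr => i _ /=.
rewrite !(mderivM, mderivD); ring.
Qed.

Definition sqn : mpoly n R := \sum_i 'x_i ^+ 2.

Lemma ev_sqn x : ev sqn x = \sum_i x ord0 i ^+ 2.
Proof.
by rewrite rmorph_sum; apply: eq_bigr => i _; rewrite rmorphXn /= mevalXU.
Qed.

Lemma mderiv_var i j : mderiv i 'x_j = (i == j)%:R :> mpoly n R.
Proof.
rewrite mderivX mnm1E eq_sym; case: eqP => [->|_]; last by rewrite scale0r.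
by rewrite mnm1_subK mpolyX0 scale1r.
Qed.

Lemma mderiv_sqn i : mderiv i sqn = 'x_i *+ 2.
Proof.
rewrite raddf_sum /= (bigD1 i)//= big1 ?addr0.
  by rewrite expr2 mderivM mderiv_var eqxx mul1r mulr1 mulr2n.
move=> j ji; rewrite expr2 mderivM mderiv_var eq_sym (negbTE ji).
by rewrite mul0r mulr0 addr0.
Qed.

Lemma mlap_sqn : mlap sqn = mpolyC n (2 * n%:R).
Proof.
rewrite /mlap; under eq_bigr do rewrite mderiv_sqn mderivMn mderiv_var eqxx.
by rewrite sumr_const card_ord mpolyCM -mulrnA !mpolyC_nat -natrM.
Qed.

(* Symmetric second differences: additive in [w] without any differentiability
   side condition, and visibly nonpositive at a maximum of [w]. *)
Definition lap_at (w : 'rV[R]_n -> R) x (l : R) :=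
  (fun t : R => \sum_i (w (x + t *: e_ i) + w (x - t *: e_ i) - 2 * w x) / t ^+ 2)
    @ 0^' --> l.

Lemma lap_atD w1 w2 x l1 l2 : lap_at w1 x l1 -> lap_at w2 x l2 ->
  lap_at (fun y => w1 y + w2 y) x (l1 + l2).
Proof.
move=> h1 h2; apply: cvg_trans (cvgD h1 h2); apply: near_eq_cvg.
near=> t; rewrite /= [LHS]/GRing.add/= -big_split; apply: eq_bigr => i _ /=.
by rewrite -mulrDl; congr (_ / _); ring.
Unshelve. all: by end_near. Qed.

Lemma lap_atN w x l : lap_at w x l -> lap_at (fun y => - w y) x (- l).
Proof.
move=> h; apply: cvg_trans (cvgN h); apply: near_eq_cvg.
near=> t; rewrite /= [LHS]/GRing.opp/= -sumrN; apply: eq_bigr => i _ /=.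
by rewrite -mulNr; congr (_ / _); ring.
Unshelve. all: by end_near. Qed.

Lemma lap_atB w1 w2 x l1 l2 : lap_at w1 x l1 -> lap_at w2 x l2 ->
  lap_at (fun y => w1 y - w2 y) x (l1 - l2).
Proof. by move=> h1 h2; apply: lap_atD => //; exact: lap_atN. Qed.

(** Writing f = f_0 + f_1 X + f_2 X^2 + g X^3, the quotient at t <> 0 equals 2 f_2 + t (g(t) -
    g(-t)), a polynomial in t whose value at 0 is f''(0). *)
Lemma poly_sdq (f : {poly R}) :
  (fun t : R => (f.[t] + f.[- t] - 2 * f.[0]) / t ^+ 2) @ 0^' --> f^`()^`().[0].
Proof.
have [g Hg] : exists g : {poly R}, f = (f`_0)%:P + f`_1 *: 'X + f`_2 *: 'X^2 + g * 'X^3.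
  exists (drop_poly 3 f); apply/polyP => i; rewrite coefD coefMXn coef_drop_poly !coefE.
  case: i => [|[|[|i]]] /=; rewrite ?mulr0 ?mulr1 ?addr0 ?add0r//.
  by rewrite !subSS subn0 addn3.
have d2 : f^`()^`().[0] = f`_2 *+ 2.
  by rewrite horner_coef0 !coef_deriv mulr1n.
pose h : {poly R} := (f`_2 *+ 2)%:P + 'X * (g - (g \Po (- 'X))).
have -> : f^`()^`().[0] = h.[0] by rewrite d2 /h !hornerE.
have hc : (fun t => h.[t]) @ (0 : R)^' --> h.[0].
  by apply: cvg_within_filter; exact: continuous_horner.
apply: cvg_trans hc; apply: near_eq_cvg; near=> t.
have t0 : t != 0 by near: t; exact: nbhs_dnbhs_neq.
have fE (y : R) : f.[y] = f`_0 + f`_1 * y + f`_2 * y ^+ 2 + g.[y] * y ^+ 3.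
  by rewrite {1}Hg !hornerE.
have -> : h.[t] = f`_2 *+ 2 + t * (g.[t] - g.[- t]).
  by rewrite /h !hornerE !horner_comp !hornerE.
rewrite !fE; field.
by rewrite t0.
Unshelve. all: by end_near. Qed.

Lemma lap_at_poly p x : lap_at (fun y => ev p y) x (ev (mlap p) x).
Proof.
have -> : ev (mlap p) x = \sum_i ev (mderiv i (mderiv i p)) x by rewrite rmorph_sum.
apply: cvg_big => // [|i _]; first exact: add_continuous.
have dl q : (line x (e_ i) q)^`() = line x (e_ i) (mderiv i q).
  rewrite deriv_line (bigD1 i)//= big1 ?addr0 => [|j ji].
    by rewrite mxE !eqxx scale1r.
  by rewrite mxE (negbTE ji) andbF scale0r.
have := poly_sdq (f := line x (e_ i) p).
rewrite !dl (horner_line _ _ (mderiv i (mderiv i p))) scale0r addr0 => H.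
apply: cvg_trans H; apply: near_eq_cvg.
by near=> t; rewrite !horner_line scaleNr scale0r addr0.
Unshelve. all: by end_near. Qed.

Lemma ev_sum (I : Type) (s : seq I) (F : I -> mpoly n R) x :
  ev (\sum_(i <- s) F i) x = \sum_(i <- s) ev (F i) x.
Proof. exact: rmorph_sum. Qed.

End Polynomials.
Arguments lap_at_poly {R n} p x.

(** * The Euclidean norm and its comparison with the sup norm *)

Section EuclidNorm.
Variables (R : realType) (n : nat).
Implicit Types (x y : 'rV[R]_n).

Lemma euclid_norm_ge0 x : 0 <= euclid_norm x.
Proof. exact: sqrtr_ge0. Qed.

Lemma sqr_euclid_norm x : euclid_norm x ^+ 2 = \sum_i x ord0 i ^+ 2.
Proof. by rewrite sqr_sqrtr// sumr_ge0// => i _; rewrite sqr_ge0. Qed.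

Lemma ev_sqnE x : ev (sqn R n) x = euclid_norm x ^+ 2.
Proof. by rewrite ev_sqn sqr_euclid_norm. Qed.

Lemma coord_le_euclid_norm x i : `|x ord0 i| <= euclid_norm x.
Proof.
rewrite -(@ler_pXn2r _ 2) ?nnegrE ?euclid_norm_ge0// real_normK ?num_real//.
rewrite sqr_euclid_norm (bigD1 i)//= lerDl sumr_ge0// => j _; exact: sqr_ge0.
Qed.

Lemma euclid_normZ t x : euclid_norm (t *: x) = `|t| * euclid_norm x.
Proof.
rewrite /euclid_norm; under eq_bigr do rewrite mxE exprMn.
by rewrite -mulr_sumr sqrtrM ?sqr_ge0// sqrtr_sqr.
Qed.

Lemma euclid_norm0 : euclid_norm (0 : 'rV[R]_n) = 0.
Proof. by rewrite -(scale0r 0) euclid_normZ normr0 mul0r. Qed.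

Lemma euclid_norm_eq0 x : euclid_norm x = 0 -> x = 0.
Proof.
move=> x0; apply/rowP => i; rewrite mxE; apply/eqP; rewrite -normr_le0 -x0.
exact: coord_le_euclid_norm.
Qed.

Lemma cauchy_schwarz x y :
  \sum_i x ord0 i * y ord0 i <= euclid_norm x * euclid_norm y.
Proof.
have [->|x0] := eqVneq x 0.
  by rewrite euclid_norm0 mul0r big1// => i _; rewrite mxE mul0r.
have [->|y0] := eqVneq y 0.
  by rewrite euclid_norm0 mulr0 big1// => i _; rewrite mxE mulr0.
have pos (z : 'rV[R]_n) : z != 0 -> 0 < euclid_norm z.
  move=> z0; rewrite lt0r euclid_norm_ge0 andbT.
  by apply: contra z0 => /eqP/euclid_norm_eq0 ->.
set a := euclid_norm x; set b := euclid_norm y.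
have ab : 0 < a * b by rewrite mulr_gt0 ?pos.
(* With s the scalar product, this sum is 2ab (ab - s); the null cases were set aside so that 2ab
   can be cancelled. *)
have : 0 <= \sum_i (b * x ord0 i - a * y ord0 i) ^+ 2.
  by rewrite sumr_ge0// => i _; rewrite sqr_ge0.
have -> : \sum_i (b * x ord0 i - a * y ord0 i) ^+ 2 =
    b ^+ 2 * (\sum_i x ord0 i ^+ 2) - 2 * (a * b) * (\sum_i x ord0 i * y ord0 i)
    + a ^+ 2 * (\sum_i y ord0 i ^+ 2).
  rewrite !mulr_sumr -sumrB -big_split; apply: eq_bigr => i _ /=; ring.
rewrite -!sqr_euclid_norm -/a -/b.
set s := \sum_i _ => h; rewrite -(ler_pM2l ab); nra.
Qed.

Lemma euclid_normD x y : euclid_norm (x + y) <= euclid_norm x + euclid_norm y.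
Proof.
rewrite -(@ler_pXn2r _ 2) ?nnegrE ?addr_ge0 ?euclid_norm_ge0// sqr_euclid_norm.
have -> : \sum_i (x + y) ord0 i ^+ 2 = \sum_i x ord0 i ^+ 2 +
    2 * (\sum_i x ord0 i * y ord0 i) + \sum_i y ord0 i ^+ 2.
  rewrite !mulr_sumr -!big_split; apply: eq_bigr => i _ /=.
  by rewrite !mxE; ring.
rewrite -!sqr_euclid_norm; have := cauchy_schwarz x y; nra.
Qed.

Lemma euclid_norm_delta i : euclid_norm (e_ i : 'rV[R]_n) = 1.
Proof.
rewrite /euclid_norm (bigD1 i)//= big1 => [|j ji]; last first.
  by rewrite mxE (negbTE ji) andbF expr0n.
by rewrite mxE !eqxx expr1n addr0 sqrtr1.
Qed.

Lemma euclid_norm_move x (t : R) i :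
  euclid_norm (x + t *: e_ i) <= euclid_norm x + `|t|.
Proof.
by rewrite (le_trans (euclid_normD _ _))// euclid_normZ euclid_norm_delta mulr1.
Qed.

Lemma mx_norm_le_euclid_norm x : `|x| <= euclid_norm x.
Proof.
rewrite [leLHS]/Num.norm/= mx_normrE; apply/bigmax_leP; split=> [|[i j] _ /=].
  exact: euclid_norm_ge0.
by rewrite ord1 coord_le_euclid_norm.
Qed.

Lemma coord_le_mx_norm x i : `|x ord0 i| <= `|x|.
Proof.
by rewrite [leRHS]/Num.norm/= mx_normrE; apply/bigmax_geP; right; exists (ord0, i).
Qed.

Lemma euclid_norm_le_mx_norm x : euclid_norm x <= n%:R * `|x|.
Proof.
rewrite -(@ler_pXn2r _ 2) ?nnegrE ?mulr_ge0 ?euclid_norm_ge0//.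
rewrite sqr_euclid_norm exprMn.
apply: (@le_trans _ _ (\sum_(i < n) `|x| ^+ 2)).
  apply: ler_sum => i _; rewrite -(real_normK (num_real (x ord0 i))).
  by rewrite ler_pXn2r ?nnegrE// coord_le_mx_norm.
rewrite sumr_const card_ord -[leLHS]mulr_natl ler_wpM2r ?sqr_ge0//.
by rewrite -natrX ler_nat; case: (n) => // k; rewrite expnS expn1 leq_pmulr.
Qed.

Lemma near_euclid_norm x (e : R) : 0 < e ->
  \forall y \near x, euclid_norm (y - x) < e.
Proof.
move=> e0; have d0 : 0 < e / (n%:R + 1) by rewrite divr_gt0// ltr_wpDl.
near=> y; rewrite (le_lt_trans (euclid_norm_le_mx_norm _))//.
have : `|x - y| < e / (n%:R + 1) by near: y; exact: (@cvgr_dist_lt _ _ _ (nbhs x) _ id x).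
rewrite distrC ltr_pdivlMr ?ltr_wpDl// mulrC; apply: le_lt_trans.
by rewrite ler_wpM2r// lerDl.
Unshelve. all: by end_near. Qed.

Lemma compact_euclid_cball (r : R) : compact [set x : 'rV[R]_n | euclid_norm x <= r].
Proof.
apply: bounded_closed_compact.
  exists r; split; first exact: num_real.
  move=> M rM x /= xr; apply: le_trans (mx_norm_le_euclid_norm x) _.
  exact: le_trans xr (ltW rM).
have [r0|r0] := ltP r 0.
  rewrite (_ : [set x | _] = set0); first exact: closed0.
  by apply/seteqP; split=> x //= xr; have := euclid_norm_ge0 x; lra.
rewrite (_ : [set x | _] = (fun x => ev (sqn R n) x) @^-1` [set y | y <= r ^+ 2]).
  by apply: preimage_closed; [move=> y _; exact: continuous_ev|exact: closed_le].
by apply/seteqP; split=> x /=; rewrite ev_sqnE ler_pXn2r ?nnegrE ?euclid_norm_ge0.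
Qed.

End EuclidNorm.

(** * The maximum principle *)

Section MaximumPrinciple.
Variables (R : realType) (n : nat).
Implicit Types (x y : 'rV[R]_n) (w : 'rV[R]_n -> R) (p : mpoly n R).

(** A maximum over the closed ball exists by compactness. At an interior one, all second differences
    with a small step are at most 0, against a positive limit; so it lies on the sphere. *)
Lemma max_principle_strict w (r M : R) :
  (forall x, euclid_norm x <= r -> {for x, continuous w}) ->
  (forall x, euclid_norm x < r -> exists2 l, 0 < l & lap_at w x l) ->
  (forall x, euclid_norm x = r -> w x <= M) ->
  forall x, euclid_norm x <= r -> w x <= M.
Proof.
move=> cw lw bw x xr.
pose A := [set y : 'rV[R]_n | euclid_norm y <= r].
have [||c] := EVT_max_rV (A := A) (f := w) _ (@compact_euclid_cball R n r).
- by exists x.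
- by apply: continuous_in_subspaceT => y /set_mem; exact: cw.
move=> /set_mem/= cr cmax.
have {}cmax y : euclid_norm y <= r -> w y <= w c by move=> yr; apply/cmax/mem_set.
apply: le_trans (cmax _ xr) _.
have {cr}/orP[/eqP/bw//|cr] : (euclid_norm c == r) || (euclid_norm c < r).
  by rewrite -le_eqVlt.
have [l l0 hl] := lw _ cr; exfalso.
near (0 : R)^' => t.
have : 0 < \sum_i (w (c + t *: e_ i) + w (c - t *: e_ i) - 2 * w c) / t ^+ 2.
  by near: t; exact: (cvgr_gt l hl).
apply/negP; rewrite -leNgt; apply: sumr_le0 => i _.
rewrite mulr_le0_ge0 ?invr_ge0 ?sqr_ge0//.
have tr : `|t| < r - euclid_norm c.
  near: t; apply: dnbhs0_lt; lra.
have h s : `|s| = `|t| -> w (c + s *: e_ i) <= w c.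
  by move=> st; apply/cmax/(le_trans (euclid_norm_move _ _ _)); rewrite st; lra.
have := h t erefl; have := h (- t) (normrN _); rewrite scaleNr; lra.
Unshelve. all: by end_near. Qed.

(** Adding L |x|^2 raises the Laplacian by 2nL >= 2L, since n >= 1, hence makes it positive; the
    values on the sphere rise by L r^2 only. *)
Lemma max_principle (n_gt0 : (0 < n)%N) w (r M L : R) : 0 < L ->
  (forall x, euclid_norm x <= r -> {for x, continuous w}) ->
  (forall x, euclid_norm x < r -> exists2 l, - L <= l & lap_at w x l) ->
  (forall x, euclid_norm x = r -> w x <= M) ->
  forall x, euclid_norm x <= r -> w x <= M + L * r ^+ 2.
Proof.
move=> L0 cw lw bw x xr.
apply: (@le_trans _ _ (w x + ev (L *: sqn R n) x)).
  by rewrite lerDl mevalZ mulr_ge0 ?(ltW L0)// ev_sqnE sqr_ge0.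
apply: (@max_principle_strict (fun y => w y + ev (L *: sqn R n) y) r) xr.
- by move=> y yr; apply: continuousD; [exact: cw|exact: continuous_ev].
- move=> y yr; have [l Ll hl] := lw _ yr; exists (l + L * (2 * n%:R)).
    by have : 1 <= n%:R :> R; [rewrite ler1n|nra].
  have := lap_at_poly (L *: sqn R n) y.
  by rewrite mlapZ mlap_sqn mevalZ mevalC; exact: lap_atD.
- by move=> y yr; rewrite mevalZ ev_sqnE yr lerD2r bw.
Qed.

(** A nonnegative Laplacian is at least -L for every L > 0; the choice L = e / r^2 costs e, which is
    arbitrary. *)
Lemma poly_max_principle (n_gt0 : (0 < n)%N) p (r M : R) : 0 < r ->
  (forall x, euclid_norm x < r -> 0 <= ev (mlap p) x) ->
  (forall x, euclid_norm x = r -> ev p x <= M) ->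
  forall x, euclid_norm x <= r -> ev p x <= M.
Proof.
move=> r0 lp bp x xr; apply/ler_addgt0Pr => e e0.
have -> : e = (e / r ^+ 2) * r ^+ 2 by rewrite divfK// expf_neq0// gt_eqF.
have L0 : 0 < e / r ^+ 2 by rewrite divr_gt0// exprn_gt0.
apply: (@max_principle n_gt0 (fun x => ev p x)) xr => //.
  by move=> y _; exact: continuous_ev.
move=> y yr; exists (ev (mlap p) y); last exact: lap_at_poly.
by have := lp _ yr; lra.
Qed.

End MaximumPrinciple.

(** * Bernstein's interior gradient estimate *)

Section HarmonicPolynomials.
Variables (R : realType) (n : nat) (n_gt0 : (0 < n)%N).
Implicit Types (x y : 'rV[R]_n) (p : mpoly n R).

(** Twice the weight A = 12 + 2n of Bernstein's function. On the half ball r^2 - |x|^2 >= r^2 / 2,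
    which yields the factor 2 sqrt A; as A >= 1, it is at most 2A. *)
Definition grad_const : R := 24 + 4 * n%:R.

(* Bernstein's trick: the Laplacian of
   [(r^2 - |x|^2)^2 (D_j p)^2 + (12 + 2n) r^2 p^2] is nonnegative. *)
Lemma harmonic_gradient p (r M : R) j : 0 < r -> mlap p = 0 ->
  (forall x, euclid_norm x <= r -> `|ev p x| <= M) ->
  forall x, euclid_norm x <= r / 2 -> `|ev (mderiv j p) x| <= grad_const * M / r.
Proof.
move=> r0 hp pM x xr.
have M0 : 0 <= M.
  by apply: le_trans (pM 0 _); rewrite ?normr_ge0// euclid_norm0 ltW.
set A : R := 12 + 2 * n%:R; have A0 : 12 <= A by rewrite lerDl.
have [eta etaE] : exists eta : mpoly n R, eta = mpolyC n (r ^+ 2) - sqn R n by eexists.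
have [g gE] : exists g, g = mderiv j p by eexists.
pose phi := eta * eta * (g * g) + (A * r ^+ 2) *: (p * p).
have hg : mlap g = 0 by rewrite gE mlap_mderiv hp mderiv0.
have deta i : mderiv i eta = - ('x_i *+ 2).
  by rewrite etaE mderivB mderivC mderiv_sqn sub0r.
have leta : mlap eta = mpolyC n (- (2 * n%:R)).
  by rewrite etaE mlapB mlapC mlap_sqn sub0r mpolyCN.
have eveta y : ev eta y = r ^+ 2 - euclid_norm y ^+ 2.
  by rewrite etaE mevalB mevalC ev_sqnE.
have evphi y : ev phi y = ev eta y ^+ 2 * ev g y ^+ 2 + A * r ^+ 2 * ev p y ^+ 2.
  by rewrite mevalD mevalZ !mevalM; ring.
have lapphi y : euclid_norm y < r -> 0 <= ev (mlap phi) y.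
  move=> yr.
  have -> : ev (mlap phi) y =
     \sum_i (8 * y ord0 i ^+ 2 * ev g y ^+ 2
             - 16 * ev eta y * y ord0 i * ev g y * ev (mderiv i g) y
             + 2 * ev eta y ^+ 2 * ev (mderiv i g) y ^+ 2)
     - 4 * n%:R * ev eta y * ev g y ^+ 2
     + A * r ^+ 2 * 2 * \sum_i (ev (mderiv i p) y ^+ 2).
    rewrite mlapD mlapZ !(mlapM, hp, hg, leta).
    rewrite !(mulr0, mul0r, addr0, add0r).
    have E1 : ev (\sum_i mderiv i eta * mderiv i eta) y = 4 * \sum_i y ord0 i ^+ 2.
      rewrite ev_sum mulr_sumr; apply: eq_bigr => i _.
      by rewrite deta mevalM mevalN mevalMn mevalXU; ring.
    have E2 : ev (\sum_i mderiv i (eta * eta) * mderiv i (g * g)) y =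
        - (8 * ev eta y * ev g y) * \sum_i y ord0 i * ev (mderiv i g) y.
      rewrite ev_sum mulr_sumr; apply: eq_bigr => i _.
      rewrite !mderivM deta !(mevalM, mevalD) mevalN mevalMn mevalXU; ring.
    have E3 q : ev (\sum_i mderiv i q * mderiv i q) y = \sum_i ev (mderiv i q) y ^+ 2.
      by rewrite ev_sum; apply: eq_bigr => i _; rewrite mevalM.
    have -> : \sum_i (8 * y ord0 i ^+ 2 * ev g y ^+ 2
             - 16 * ev eta y * y ord0 i * ev g y * ev (mderiv i g) y
             + 2 * ev eta y ^+ 2 * ev (mderiv i g) y ^+ 2) =
        8 * ev g y ^+ 2 * (\sum_i y ord0 i ^+ 2)
        - 16 * ev eta y * ev g y * (\sum_i y ord0 i * ev (mderiv i g) y)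
        + 2 * ev eta y ^+ 2 * (\sum_i ev (mderiv i g) y ^+ 2).
      move: (ev eta y) (ev g y) => b c.
      rewrite !mulr_sumr -sumrB -big_split; apply: eq_bigr => i _ /=.
      by move: (ev _ y) => d; ring.
    rewrite !(mevalD, mevalM, mevalZ, mevalMn) mevalC E1 E2 !E3; ring.
  (* With a = y_i, b = eta, c = g and d = D_i g, each summand is 2 (bd - 4ac)^2 - 24 a^2 c^2: a
     square absorbs the second derivatives of [p]. *)
  have s1 : - (24 * euclid_norm y ^+ 2 * ev g y ^+ 2) <=
     \sum_i (8 * y ord0 i ^+ 2 * ev g y ^+ 2
             - 16 * ev eta y * y ord0 i * ev g y * ev (mderiv i g) y
             + 2 * ev eta y ^+ 2 * ev (mderiv i g) y ^+ 2).
    rewrite sqr_euclid_norm mulr_sumr mulr_suml -sumrN; apply: ler_sum => i _.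
    rewrite -subr_ge0.
    set a := y ord0 i; set b := ev eta y; set c := ev g y; set d := ev _ y.
    have -> : 8 * a ^+ 2 * c ^+ 2 - 16 * b * a * c * d + 2 * b ^+ 2 * d ^+ 2 -
      - (24 * a ^+ 2 * c ^+ 2) = 2 * (b * d - 4 * a * c) ^+ 2 by ring.
    by rewrite mulr_ge0// sqr_ge0.
  have s2 : ev g y ^+ 2 <= \sum_i (ev (mderiv i p) y ^+ 2).
    by rewrite gE (bigD1 j)//= lerDl sumr_ge0// => i _; exact: sqr_ge0.
  have y0 := euclid_norm_ge0 y.
  have yr2 : euclid_norm y ^+ 2 <= r ^+ 2 by rewrite ler_pXn2r ?nnegrE ?(ltW r0)// ltW.
  have := sqr_ge0 (euclid_norm y); move: yr2 s1 s2; rewrite eveta.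
  have := sqr_ge0 (ev g y); have := ler0n R n; rewrite /A.
  set N := euclid_norm y ^+ 2; set G := ev g y ^+ 2; set S := \sum_i _; set T := \sum_i _.
  set r2 := r ^+ 2; set k := n%:R => k0 G0 Nr s1 s2 N0.
  (* As G <= T, the Laplacian is at least 24 (r^2 - N) G + 4n N G; the weight 12 + 2n is chosen for
     this. *)
  have t1 : 0 <= (12 + 2 * k) * r2 * 2 * (T - G).
    by rewrite mulr_ge0 ?subr_ge0// mulr_ge0// mulr_ge0 ?sqr_ge0// addr_ge0// mulr_ge0.
  have t2 : 0 <= (r2 - N) * G by rewrite mulr_ge0// subr_ge0.
  have t3 : 0 <= k * (N * G) by apply: mulr_ge0 => //; exact: mulr_ge0.
  nra.
have bphi y : euclid_norm y = r -> ev phi y <= A * r ^+ 2 * M ^+ 2.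
  move=> yr; rewrite evphi eveta yr subrr expr0n mul0r add0r.
  have A1 : 0 <= A by lra.
  rewrite ler_wpM2l ?mulr_ge0 ?(ltW r0)//.
  rewrite -(real_normK (num_real (ev p y))) ler_pXn2r ?nnegrE//.
  by rewrite pM// yr.
have xr' : euclid_norm x <= r by lra.
have := poly_max_principle n_gt0 r0 lapphi bphi xr'.
rewrite evphi eveta -/g => h.
have x0 := euclid_norm_ge0 x.
have e1 : r ^+ 2 / 2 <= r ^+ 2 - euclid_norm x ^+ 2 by nra.
have e2 : (r ^+ 2 / 2) ^+ 2 <= (r ^+ 2 - euclid_norm x ^+ 2) ^+ 2.
  by rewrite ler_pXn2r ?nnegrE//; nra.
have e3 : (r ^+ 2 / 2) ^+ 2 * ev g x ^+ 2 <= A * r ^+ 2 * M ^+ 2.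
  apply: le_trans h.
  apply: (@le_trans _ _ ((r ^+ 2 - euclid_norm x ^+ 2) ^+ 2 * ev g x ^+ 2)).
    by rewrite ler_wpM2r ?sqr_ge0.
  by rewrite lerDl mulr_ge0 ?sqr_ge0// mulr_ge0 ?sqr_ge0//; lra.
rewrite ler_pdivlMr// -(@ler_pXn2r _ 2) ?nnegrE ?mulr_ge0 ?(ltW r0)//; last first.
  by rewrite /grad_const addr_ge0 ?mulr_ge0.
rewrite exprMn real_normK ?num_real// -(ler_pM2l (exprn_gt0 2 r0)).
have -> : grad_const = 2 * A by rewrite /grad_const /A; ring.
rewrite -gE; have : 0 <= r ^+ 2 * M ^+ 2 * (A - 1) * A.
  by rewrite !mulr_ge0 ?sqr_ge0//; lra.
move: e3; move: (ev g x) (A) => c B; nra.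
Qed.

End HarmonicPolynomials.

(** * Coefficients and Taylor remainders of harmonic polynomials *)

Section CoefficientBounds.
Variables (R : realType) (n : nat).
Implicit Types (x y : 'rV[R]_n) (p : mpoly n R) (b : multinom n).

Lemma ev0 p : ev p (0 : 'rV[R]_n) = mcoeff mnm0 p.
Proof.
elim/mpoly_ring_ind: p => [c|i|p q Hp Hq|p q Hp Hq].
- by rewrite mevalC mcoeffC eqxx mulr1.
- by rewrite mevalXU mxE mcoeffX mnm1_eq0.
- by rewrite mevalD mcoeffD Hp Hq.
- by rewrite mevalM rmorphM Hp Hq.
Qed.

Lemma ler_norm_mulrn (a : R) k : `|a| <= `|a *+ k.+1|.
Proof. by rewrite normrMn mulrS lerDl mulrn_wge0. Qed.

Lemma harmonic_coef (n_gt0 : (0 < n)%N) k : exists2 C : R, 0 <= C &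
  forall p (r M : R) b, 0 < r -> mlap p = 0 ->
  (forall x, euclid_norm x <= r -> `|ev p x| <= M) -> mdeg b = k ->
  `|mcoeff b p| <= C * M / r ^+ k.
Proof.
elim: k => [|k [C C0 IH]].
  exists 1 => // p r M b r0 _ pM /eqP; rewrite mdeg_eq0 => /eqP ->.
  by rewrite -ev0 mul1r divr1 pM// euclid_norm0 ltW.
exists (C * grad_const R n * 2 ^+ k).
  by rewrite !mulr_ge0// ?exprn_ge0// /grad_const addr_ge0// mulr_ge0.
move=> p r M b r0 hp pM bk.
have [i bi] : exists i, b i != 0%N.
  apply/existsP; apply: contraPT bk; rewrite negb_exists => /forallP h.
  rewrite (_ : b = mnm0) ?mdeg0//; apply/mnmP => i; rewrite mnm0E.
  by apply/eqP; have := h i; rewrite negbK.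
have bE : mnm_add (mnm_sub b (mnm1 i)) (mnm1 i) = b.
  by rewrite submK// lep1mP.
have dk : mdeg (mnm_sub b (mnm1 i)) = k.
  by move: bk; rewrite -bE mdegD mdeg1 addn1 bE => -[].
have r20 : 0 < r / 2 by lra.
have hd : mlap (mderiv i p) = 0 by rewrite mlap_mderiv hp mderiv0.
have := IH _ _ _ _ r20 hd (harmonic_gradient n_gt0 i r0 hp pM) dk.
rewrite mcoeff_mderiv bE => /(le_trans (ler_norm_mulrn _ _))/le_trans; apply.
rewrite le_eqVlt; apply/orP; left; apply/eqP.
by rewrite exprMn exprVn exprS; field; rewrite ?expf_neq0 gt_eqF.
Qed.

(** The Taylor remainder of order k at the origin. *)
Definition mtail k p : mpoly n R :=
  \sum_(b <- msupp p | (k <= mdeg b)%N) mcoeff b p *: mpolyX R b.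

Lemma mcoeff_mtail k p b :
  mcoeff b (mtail k p) = if (k <= mdeg b)%N then mcoeff b p else 0.
Proof.
rewrite /mtail raddf_sum /=.
under eq_bigr do rewrite mcoeffZ mcoeffX.
have [bp|bp] := boolP (b \in msupp p); last first.
  rewrite (memN_msupp_eq0 bp) if_same big1_seq// => c /andP[_ cp].
  by case: eqP => [cb|]; rewrite ?mulr0//; rewrite cb (negbTE bp) in cp.
rewrite big_mkcond (bigD1_seq b)//= ?msupp_uniq// eqxx mulr1 big1 ?addr0// => c cb.
by rewrite (negbTE cb) mulr0 if_same.
Qed.

Lemma mtail0 p : mtail 0 p = p.
Proof. by apply/mpolyP => b; rewrite mcoeff_mtail. Qed.

Lemma mtailD k p q : mtail k (p + q) = mtail k p + mtail k q.
Proof.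
apply/mpolyP => b; rewrite mcoeffD !mcoeff_mtail mcoeffD.
by case: ifP => //; rewrite addr0.
Qed.

Lemma mderiv_mtail k i p : mderiv i (mtail k.+1 p) = mtail k (mderiv i p).
Proof.
apply/mpolyP => b; rewrite !(mcoeff_mderiv, mcoeff_mtail) mdegD mdeg1 addn1 ltnS.
by case: ifP => //; rewrite mul0rn.
Qed.

Lemma poly_mvt (f : {poly R}) :
  exists2 c, 0 < c < 1 & f.[1] - f.[0] = f^`().[c].
Proof.
have h1 (x : R) : x \in `]0, 1[ -> is_derive x 1 (horner f) (f^`().[x]).
  by move=> _; rewrite derivE derive1E; apply: derivableP; exact: derivable_horner.
have h2 : {within `[(0 : R), 1], continuous (horner f)}.
  by apply: continuous_subspaceT; exact: continuous_horner.
have [c c01 ->] := MVT ltr01 h1 h2.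
by rewrite subr0 mulr1; exists c => //; move: c01; rewrite in_itv.
Qed.

(** The coefficient bounds cannot be summed over all degrees, as their constants grow too fast.
    Instead, the remainder of order k + 1 vanishes at 0, its derivatives are the remainders of order
    k of the harmonic D_i p, and the mean value theorem on the segment from 0 to x adds one factor
    |x|. *)
Lemma harmonic_tail (n_gt0 : (0 < n)%N) k : exists2 C : R, 0 <= C &
  forall p (r M : R), 0 < r -> mlap p = 0 ->
  (forall x, euclid_norm x <= r -> `|ev p x| <= M) ->
  forall x, euclid_norm x <= r / 2 ^+ k ->
  `|ev (mtail k p) x| <= C * M * (euclid_norm x / r) ^+ k.
Proof.
elim: k => [|k [C C0 IH]].
  exists 1 => // p r M r0 _ pM x; rewrite divr1 mtail0 !mul1r mulr1; exact: pM.
exists (n%:R * C * grad_const R n * 2 ^+ k).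
  by rewrite !mulr_ge0// ?exprn_ge0// /grad_const addr_ge0// mulr_ge0.
move=> p r M r0 hp pM x xr.
have x0 := euclid_norm_ge0 x.
have M0 : 0 <= M.
  by apply: le_trans (pM 0 _); rewrite ?normr_ge0// euclid_norm0 ltW.
have [c /andP[c0 c1]] := poly_mvt (line 0 x (mtail k.+1 p)).
rewrite deriv_line !horner_line scale1r scale0r !add0r ev0 mcoeff_mtail mdeg0 subr0.
rewrite horner_sum => ->.
have gc0 : 0 <= grad_const R n by rewrite /grad_const addr_ge0// mulr_ge0.
have cx : euclid_norm (c *: x) <= euclid_norm x.
  by rewrite euclid_normZ gtr0_norm//; nra.
pose B := C * (grad_const R n * M / r) * (euclid_norm x / (r / 2)) ^+ k.
have hB i : `|(x ord0 i *: line 0 x (mderiv i (mtail k.+1 p))).[c]| <= euclid_norm x * B.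
  rewrite hornerZ normrM horner_line add0r mderiv_mtail.
  apply: ler_pM => //; first exact: coord_le_euclid_norm.
  have r20 : 0 < r / 2 by lra.
  have hd : mlap (mderiv i p) = 0 by rewrite mlap_mderiv hp mderiv0.
  apply: le_trans (IH _ _ _ r20 hd (harmonic_gradient n_gt0 i r0 hp pM) _ _) _.
    apply: le_trans cx (le_trans xr _).
    by rewrite exprS invfM mulrA.
  rewrite /B ler_wpM2l ?mulr_ge0 ?invr_ge0 ?(ltW r0)//.
  rewrite lerXn2r ?nnegrE ?divr_ge0 ?euclid_norm_ge0 ?(ltW r20) ?(ltW r0)//.
  by rewrite ler_wpM2r// invr_ge0 ltW.
apply: le_trans (ler_norm_sum _ _ _) _.
apply: le_trans (ler_sum _ (fun i _ => hB i)) _.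
rewrite sumr_const card_ord -[leLHS]mulr_natl /B.
rewrite le_eqVlt; apply/orP; left; apply/eqP.
by rewrite !exprMn !exprVn !exprMn exprVn !exprS; field; rewrite ?expf_neq0 gt_eqF.
Qed.

End CoefficientBounds.

(** * The Dirichlet problem and Poisson's equation inside the polynomials *)

Section Dirichlet.
Variables (R : realType) (n : nat) (n_gt0 : (0 < n)%N).
Implicit Types (x y : 'rV[R]_n) (p q : mpoly n R) (b : multinom n).

Definition deg_lt k p := forall b, (k <= mdeg b)%N -> mcoeff b p = 0.

Lemma deg_ltP k p : deg_lt k p <-> (msize p <= k)%N.
Proof.
split=> [h|h b kb]; last first.
  by apply: memN_msupp_eq0; apply: msize_mdeg_ge; exact: leq_trans kb.
rewrite msizeE; apply/bigmax_leqP_seq => b bp _; rewrite ltnNge.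
by apply: contraTN bp => /h; rewrite mcoeff_msupp negbK => ->.
Qed.

Lemma deg_lt_mderiv k i p : deg_lt k.+1 p -> deg_lt k (mderiv i p).
Proof.
by move=> h b kb; rewrite mcoeff_mderiv h ?mul0rn// mdegD mdeg1 addn1.
Qed.

Lemma deg_lt_sum k (I : Type) (s : seq I) (F : I -> mpoly n R) :
  (forall i, deg_lt k (F i)) -> deg_lt k (\sum_(i <- s) F i).
Proof. by move=> h b kb; rewrite raddf_sum big1// => i _; exact: h. Qed.

Lemma deg_ltZ k c p : deg_lt k p -> deg_lt k (c *: p).
Proof. by move=> h b kb; rewrite mcoeffZ h ?mulr0. Qed.

Lemma deg_ltD k p q : deg_lt k p -> deg_lt k q -> deg_lt k (p + q).
Proof. by move=> hp hq b kb; rewrite mcoeffD hp ?hq ?addr0. Qed.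

Lemma deg_lt_mlap k p : deg_lt k.+2 p -> deg_lt k (mlap p).
Proof. by move=> h; apply: deg_lt_sum => i; do 2 apply: deg_lt_mderiv. Qed.

Lemma deg_lt_mulX k i p : deg_lt k p -> deg_lt k.+1 ('x_i * p).
Proof.
have [->|p0] := eqVneq p 0; first by rewrite mulr0 => _ b _; rewrite mcoeff0.
have x0 : 'x_i != 0 :> mpoly n R by rewrite -msize_poly_eq0 msizeX.
by move=> /deg_ltP h; apply/deg_ltP; rewrite msizeM// msizeX mdeg1.
Qed.

(** Vanishes on the sphere of radius [r]: adding a multiple of it keeps the boundary values
    there. *)
Definition cutoff (r : R) : mpoly n R := mpolyC n (r ^+ 2) - sqn R n.

Lemma deg_lt_cutoff k r p : deg_lt k p -> deg_lt k.+2 (cutoff r * p).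
Proof.
move=> h; rewrite mulrBl mul_mpolyC -scaleN1r; apply: deg_ltD.
  by move=> b kb; rewrite mcoeffZ h ?mulr0//; do 2 apply: ltnW.
rewrite mulr_suml; apply/deg_ltZ/deg_lt_sum => i.
by rewrite expr2 -mulrA; do 2 apply: deg_lt_mulX.
Qed.

Lemma ev_cutoff r x : ev (cutoff r) x = r ^+ 2 - euclid_norm x ^+ 2.
Proof. by rewrite mevalB mevalC ev_sqnE. Qed.

(** The product is harmonic and vanishes on the sphere, so it is 0 on the ball by the maximum
    principle, and its coefficients are 0 by [harmonic_coef] with M = 0. Polynomials form an
    integral domain and the cutoff is nonzero, so q = 0. *)
Lemma cutoff_laplacian_inj (r : R) q : 0 < r -> mlap (cutoff r * q) = 0 -> q = 0.
Proof.
move=> r0 hq.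
have b0 x : euclid_norm x = r -> ev (cutoff r * q) x = 0.
  by move=> xr; rewrite mevalM ev_cutoff xr subrr mul0r.
have W0 x : euclid_norm x <= r -> `|ev (cutoff r * q) x| <= 0.
  move=> xr; rewrite ler_norml oppr0; apply/andP; split.
    rewrite -oppr_le0 -mevalN; apply: (poly_max_principle n_gt0 r0) xr.
      by move=> y _; rewrite mlapN hq oppr0 meval0.
    by move=> y yr; rewrite mevalN b0// oppr0.
  apply: (poly_max_principle n_gt0 r0) xr => [y _|y yr]; first by rewrite hq meval0.
  by rewrite b0.
have /eqP : cutoff r * q = 0.
  apply/mpolyP => b; rewrite mcoeff0; apply/eqP; rewrite -normr_le0.
  have [C C0 h] := harmonic_coef R n_gt0 (mdeg b).
  by apply: le_trans (h _ _ _ _ r0 hq W0 erefl) _; rewrite mulr0 mul0r.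
rewrite mulf_eq0 => /orP[/eqP b1|/eqP//].
have := ev_cutoff r 0; rewrite b1 meval0 euclid_norm0 expr0n subr0 => /eqP.
by rewrite eq_sym expf_eq0/= gt_eqF.
Qed.

(** The cutoff raises the degree by 2 and the Laplacian lowers it by 2: q |-> lap (cutoff q) is an
    endomorphism of the finite-dimensional space of polynomials of degree < k, so injectivity gives
    surjectivity. *)
Lemma cutoff_laplacian_surj (r : R) k p : 0 < r -> deg_lt k p ->
  exists2 q, deg_lt k q & mlap (cutoff r * q) = p.
Proof.
move=> r0 hp.
pose I : finType := bmultinom n k; pose N := #|I|.
pose mon (i : 'I_N) : multinom n := bmnm (enum_val i : I).
pose T q := mlap (cutoff r * q).
pose P (v : 'rV[R]_N) : mpoly n R := \sum_i v ord0 i *: mpolyX R (mon i).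
have TP v : T (P v) = \sum_i v ord0 i *: T (mpolyX R (mon i)).
  rewrite /T /P mulr_sumr (big_morph _ (@mlapD R n) (@mlap0 R n)).
  by apply: eq_bigr => i _; rewrite -scalerAr mlapZ.
have degP v : deg_lt k (P v).
  apply: deg_lt_sum => i; apply: deg_ltZ => b kb; rewrite mcoeffX.
  case: eqP => // monb; exfalso; have := bmdeg (enum_val i : I).
  by rewrite -/(mon i) monb ltnNge kb.
have coefP v j : mcoeff (mon j) (P v) = v ord0 j.
  rewrite raddf_sum (bigD1 j)//= mcoeffZ mcoeffX eqxx mulr1 big1 ?addr0// => i ij.
  rewrite mcoeffZ mcoeffX; case: eqP => [h|]; rewrite ?mulr0//.
  by case/eqP: ij; apply: enum_val_inj; exact/val_inj.
have onto b : (mdeg b < k)%N -> exists j, mon j = b.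
  move=> bk; exists (enum_rank (BMultinom bk : I)).
  by rewrite /mon enum_rankK.
pose A : 'M[R]_N := \matrix_(i, j) mcoeff (mon j) (T (mpolyX R (mon i))).
have vA v j : (v *m A) ord0 j = mcoeff (mon j) (T (P v)).
  rewrite mxE TP raddf_sum; apply: eq_bigr => i _ /=.
  by rewrite mxE mcoeffZ.
have A_unit : A \in unitmx.
  rewrite -row_free_unit; apply: inj_row_free => v vA0.
  have P0 : P v = 0.
    apply: (cutoff_laplacian_inj r0); apply/mpolyP => b; rewrite mcoeff0.
    have [/onto[j <-]|kb] := ltnP (mdeg b) k; first by rewrite -vA vA0 mxE.
    by apply: deg_lt_mlap kb; exact: deg_lt_cutoff.
  by apply/rowP => j; rewrite -coefP P0 mcoeff0 mxE.
pose v := (\row_j mcoeff (mon j) p) *m invmx A.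
exists (P v) => //; apply/mpolyP => b.
have [/onto[j <-]|kb] := ltnP (mdeg b) k.
  by rewrite -vA /v mulmxKV// mxE.
by rewrite hp//; apply: deg_lt_mlap kb; exact: deg_lt_cutoff.
Qed.

(** The polynomial p - cutoff q has the boundary values of p, and is harmonic as soon as lap (cutoff
    q) = lap p. *)
Lemma dirichlet (r : R) p : 0 < r ->
  exists2 h, mlap h = 0 & forall x, euclid_norm x = r -> ev h x = ev p x.
Proof.
move=> r0; have dp : deg_lt (msize p) (mlap p).
  by apply: deg_lt_mlap; apply/deg_ltP; rewrite -addn2 leq_addr.
have [q _ hq] := cutoff_laplacian_surj r0 dp.
exists (p - cutoff r * q); first by rewrite mlapB hq subrr.
by move=> x xr; rewrite mevalB mevalM ev_cutoff xr subrr mul0r subr0.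
Qed.

(** Only finitely many monomials have degree < k: a solution is fixed for each, on the unit ball,
    and extended linearly. The constant adds up the absolute values of all their coefficients. *)
Lemma poisson_polynomial k : exists2 C : R, 0 <= C &
  forall p (L : R), deg_lt k p -> (forall b, `|mcoeff b p| <= L) ->
  exists q, [/\ deg_lt k.+2 q, mlap q = p & forall b, `|mcoeff b q| <= C * L].
Proof.
have ex (m : bmultinom n k) : exists q : mpoly n R,
    deg_lt k.+2 q /\ mlap q = mpolyX R (bmnm m).
  have dm : deg_lt k (mpolyX R (bmnm m)).
    move=> b kb; rewrite mcoeffX; case: eqP => // mb.
    by have := bmdeg m; rewrite mb ltnNge kb.
  have [q dq hq] := cutoff_laplacian_surj ltr01 dm.
  by exists (cutoff 1 * q); split=> //; exact: deg_lt_cutoff.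
have [Q hQ] := choice ex.
exists (\sum_(m : bmultinom n k) \sum_(c : bmultinom n k.+2) `|mcoeff (bmnm c) (Q m)|).
  by apply: sumr_ge0 => m _; apply: sumr_ge0.
move=> p L dp pL.
have dq : deg_lt k.+2 (\sum_(m : bmultinom n k) mcoeff (bmnm m) p *: Q m).
  by apply: deg_lt_sum => m; apply: deg_ltZ; exact: (hQ m).1.
exists (\sum_(m : bmultinom n k) mcoeff (bmnm m) p *: Q m); split => //.
  rewrite (big_morph _ (@mlapD R n) (@mlap0 R n)) [RHS](@mpolywE _ _ k); last exact/deg_ltP.
  by apply: eq_bigr => m _; rewrite mlapZ (hQ m).2.
move=> b; have L0 : 0 <= L by apply: le_trans (pL b).
have [bk|kb] := ltnP (mdeg b) k.+2; last first.
  by rewrite dq// normr0 mulr_ge0// sumr_ge0// => m _; rewrite sumr_ge0.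
rewrite raddf_sum mulr_suml; apply: le_trans (ler_norm_sum _ _ _) _.
apply: ler_sum => m _ /=; rewrite mcoeffZ normrM mulrC; apply: ler_pM => //.
by rewrite (bigD1 (BMultinom bk))//= lerDl sumr_ge0.
Qed.

End Dirichlet.

(** * Weierstrass approximation and approximation by harmonic polynomials *)

Section Weierstrass.
Variables (R : realType) (n : nat).
Implicit Types (x z : 'rV[R]_n) (phi : 'rV[R]_n -> R).

(* The Bernstein operator of a random walk taking, for each [i] in the list, a
   step [t] in direction [i] with probability [Y i]. *)
Fixpoint walk (A : nzRingType) (inj : R -> A) (Y : 'I_n -> A) (t : R)
    (l : seq 'I_n) phi z : A :=
  if l is i :: l' then
    Y i * walk inj Y t l' phi (z + t *: e_ i) + (1 - Y i) * walk inj Y t l' phi z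
  else inj (phi z).

Lemma ev_walk (Y : 'I_n -> mpoly n R) t l phi z x :
  ev (walk (@mpolyC n R) Y t l phi z) x =
  walk id (fun i => ev (Y i) x) t l phi z :> R.
Proof.
elim: l z => [|i l IH] z /=; first by rewrite mevalC.
by rewrite mevalD !mevalM mevalB meval1 !IH.
Qed.

Lemma walk_le (y : 'I_n -> R) t l phi psi z : (forall i, 0 <= y i <= 1) ->
  (forall z, phi z <= psi z) ->
  walk id y t l phi z <= walk id y t l psi z.
Proof.
move=> y01 le; elim: l z => [|i l IH] z /=; first exact: le.
by have /andP[y0 y1] := y01 i; rewrite lerD// ler_wpM2l// subr_ge0.
Qed.

(** Squared bias plus variance: the j-th coordinate of the end point is z_j plus t times a sum of
    [count_mem j l] independent Bernoulli variables of parameter y_j. *)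
Lemma walk_quadratic (y : 'I_n -> R) t l (c K : R) x z :
  walk id y t l (fun z => c + K * euclid_norm (z - x) ^+ 2) z =
  c + K * \sum_j ((z ord0 j - x ord0 j + (count_mem j l)%:R * t * y j) ^+ 2
                  + (count_mem j l)%:R * t ^+ 2 * (y j * (1 - y j))).
Proof.
elim: l z => [|i l IH] z.
  rewrite /= sqr_euclid_norm; congr (_ + _ * _); apply: eq_bigr => j _.
  by rewrite !mxE !mul0r !addr0.
rewrite [LHS]/= !IH.
set S1 := \sum_j _; set S2 := \sum_j _; set S3 := \sum_j _.
suff -> : S3 = y i * S1 + (1 - y i) * S2 by ring.
rewrite /S1 /S2 /S3 !mulr_sumr -big_split; apply: eq_bigr => j _ /=.
rewrite !mxE natrD eq_refl/= [i == j]eq_sym; case: (eqVneq j i) => [->|_] /=; ring.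
Qed.

(** The walk starts at the corner (-r, ..., -r) and attempts N steps of length 2r / N in each
    direction, with probability (x_i + r) / (2r), so that its end point has mean x and the bias
    vanishes. Monotonicity carries the quadratic bound on g - g(x) over to the walk, leaving e plus
    K times the variance. *)
Lemma poly_approx (g : 'rV[R]_n -> R) (r e K : R) : 0 < r -> 0 < e -> 0 <= K ->
  (forall x z, euclid_norm x <= r -> `|g z - g x| <= e + K * euclid_norm (z - x) ^+ 2) ->
  exists p, forall x, euclid_norm x <= r -> `|g x - ev p x| <= e *+ 2.
Proof.
move=> r0 e0 K0 gK.
pose Y i : mpoly n R := (2 * r)^-1 *: ('x_i + mpolyC n r).
(* The variance is at most 4 n r^2 / N; this N makes K times it at most e. *)
pose N := (Num.truncn (K * n%:R * 4 * r ^+ 2 / e)).+1.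
pose t := 2 * r / N%:R.
pose l := flatten (nseq N (enum 'I_n)).
exists (walk (@mpolyC n R) Y t l g (const_mx (- r))) => x xr.
pose y i := ev (Y i) x.
have yE i : y i = (x ord0 i + r) / (2 * r).
  by rewrite /y /Y mevalZ mevalD mevalXU mevalC mulrC.
have y01 i : 0 <= y i <= 1.
  have := le_trans (coord_le_euclid_norm x i) xr; rewrite ler_norml => /andP[a b].
  by rewrite yE divr_ge0 ?ler_pdivrMr ?mulr_gt0//=; lra.
have N0 : 0 < N%:R :> R by rewrite ltr0n.
have cl j : count_mem j l = N.
  rewrite /l count_flatten map_nseq sumn_nseq count_uniq_mem ?enum_uniq//.
  by rewrite mem_enum mul1n.
have quad c K' : walk id y t l (fun z => c + K' * euclid_norm (z - x) ^+ 2) (const_mx (- r))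
    = c + K' * \sum_j (t ^+ 2 * N%:R * (y j * (1 - y j))).
  rewrite walk_quadratic; congr (_ + _ * _); apply: eq_bigr => j _.
  rewrite cl mxE (_ : - r - _ + _ = 0) ?expr0n ?add0r ?[N%:R * _]mulrC//.
  by rewrite yE /t; field; rewrite ?gt_eqF.
have V : K * \sum_j (t ^+ 2 * N%:R * (y j * (1 - y j))) <= e.
  apply: (@le_trans _ _ (K * (n%:R * (t ^+ 2 * N%:R)))).
    rewrite ler_wpM2l// mulr_natl -[n in leRHS]card_ord -sumr_const.
    apply: ler_sum => j _; apply: ler_piMr; first by rewrite mulr_ge0 ?sqr_ge0.
    by have /andP[] := y01 j; nra.
  have -> : K * (n%:R * (t ^+ 2 * N%:R)) = (K * n%:R * 4 * r ^+ 2) / N%:R.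
    by rewrite /t; field; rewrite gt_eqF.
  rewrite ler_pdivrMr// [leRHS]mulrC -ler_pdivrMr//.
  by apply: ltW; rewrite /N truncnS_gt.
rewrite ev_walk -/y ler_distlC; apply/andP; split.
  apply: (@le_trans _ _ (g x - e + - K * \sum_j (t ^+ 2 * N%:R * (y j * (1 - y j))))).
    by rewrite mulNr; lra.
  rewrite -quad; apply: walk_le => // z.
  by have := gK _ z xr; rewrite ler_norml mulNr => /andP[]; lra.
apply: (@le_trans _ _ (g x + e + K * \sum_j (t ^+ 2 * N%:R * (y j * (1 - y j))))).
  rewrite -quad; apply: walk_le => // z.
  by have := gK _ z xr; rewrite ler_norml => /andP[]; lra.
by lra.
Qed.

(** By compactness some d makes the oscillation of v at most e over distances below d, uniformly in
    x; at larger distances 2M <= (2M / d^2) |z - x|^2. This is the hypothesis of [poly_approx]. *)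
Lemma quadratic_modulus (v : 'rV[R]_n -> R) (r s M e : R) : r < s -> 0 < e -> 0 <= M ->
  (forall x, euclid_norm x < s -> {for x, continuous v}) ->
  (forall x, `|v x| <= M) ->
  exists2 K, 0 <= K & forall x z, euclid_norm x <= r ->
    `|v z - v x| <= e + K * euclid_norm (z - x) ^+ 2.
Proof.
move=> rs e0 M0 cv vM.
have /compact_near_coveringP cK := @compact_euclid_cball R n r.
have : \forall d \near (0 : R)^'+, [set x : 'rV[R]_n | euclid_norm x <= r] `<=`
    (fun x => forall z, euclid_norm (z - x) < d -> `|v z - v x| <= e).
  apply: cK => x xr.
  have xs : euclid_norm x < s by exact: le_lt_trans xr rs.
  have e20 : 0 < e / 2 by lra.
  have /nbhs_ballP[d /= d0 hd] : \forall z \near x, `|v x - v z| < e / 2.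
    by apply: (@cvgr_dist_lt _ _ _ (nbhs x) _ v (v x)) => //; exact: cv.
  have hd' z : euclid_norm (z - x) < d -> `|v x - v z| < e / 2.
    move=> zx; apply: hd; rewrite -ball_normE/= distrC.
    exact: le_lt_trans (mx_norm_le_euclid_norm _) zx.
  have d20 : 0 < d / 2 by lra.
  exists ([set y | euclid_norm (y - x) < d / 2], [set a | a < d / 2]).
    split => /=; first exact: near_euclid_norm.
    exact: nbhs_right_lt.
  move=> [y a] /= [yx ad] z zy.
  have zx : euclid_norm (z - x) < d.
    have -> : z - x = (z - y) + (y - x) by rewrite addrA subrK.
    by apply: le_lt_trans (euclid_normD _ _) _; lra.
  have := hd' _ zx; have := hd' y (lt_trans yx _); rewrite !ltr_norml ler_norml.
  move=> /(_ _)/andP; lra.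
move=> near_d; near (0 : R)^'+ => d.
have d0 : 0 < d by near: d; exact: nbhs_right_gt.
have hd : [set x : 'rV[R]_n | euclid_norm x <= r] `<=`
    (fun x => forall z, euclid_norm (z - x) < d -> `|v z - v x| <= e) by near: d.
exists (2 * M / d ^+ 2); first by rewrite divr_ge0 ?mulr_ge0 ?sqr_ge0.
move=> x z xr; have [zx|zx] := ltP (euclid_norm (z - x)) d.
  apply: le_trans (hd _ xr _ zx) _.
  by rewrite lerDl mulr_ge0 ?sqr_ge0// divr_ge0 ?mulr_ge0 ?sqr_ge0.
apply: le_trans (ler_normB _ _) _.
apply: (@le_trans _ _ (2 * M)); first by have := vM x; have := vM z; lra.
rewrite -[leLHS]add0r lerD ?(ltW e0)// mulrAC ler_pdivlMr ?exprn_gt0//.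
by rewrite ler_wpM2l ?mulr_ge0// lerXn2r ?nnegrE ?(ltW d0) ?euclid_norm_ge0.
Unshelve. all: by end_near. Qed.

Lemma weierstrass (v : 'rV[R]_n -> R) (r s M e : R) : 0 < r -> r < s -> 0 < e ->
  (forall x, euclid_norm x < s -> {for x, continuous v}) ->
  (forall x, euclid_norm x < s -> `|v x| <= M) ->
  exists p, forall x, euclid_norm x <= r -> `|v x - ev p x| <= e.
Proof.
move=> r0 rs e0 cv vM.
have M0 : 0 <= M.
  by apply: le_trans (vM 0 _); rewrite ?normr_ge0// euclid_norm0 (lt_trans r0).
(* The walk visits points of the cube [-r, r]^n, which may leave the ball of radius s; outside that
   ball v is replaced by 0. *)
pose g x := if euclid_norm x < s then v x else 0.
have gv x : euclid_norm x < s -> \forall y \near x, v y = g y.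
  move=> xs; have d0 : 0 < s - euclid_norm x by lra.
  have := near_euclid_norm x d0; apply: filterS => y yx.
  rewrite /g ifT// -[y](subrK x); apply: le_lt_trans (euclid_normD _ _) _; lra.
have cg x : euclid_norm x < s -> {for x, continuous g}.
  move=> xs; have := cv _ xs; rewrite /prop_for /continuous_at {2}/g xs => h.
  exact: (cvg_trans (near_eq_cvg (gv x xs)) h).
have gM x : `|g x| <= M by rewrite /g; case: ifP => [/vM//|]; rewrite normr0.
have e20 : 0 < e / 2 by lra.
have [K K0 hK] := quadratic_modulus rs e20 M0 cg gM.
have [p hp] := poly_approx r0 e20 K0 hK.
exists p => x xr; have := hp _ xr; rewrite /g ifT ?(le_lt_trans xr)//; lra.
Qed.

Lemma harmonic_approx (n_gt0 : (0 < n)%N) (v : 'rV[R]_n -> R) (r s M L e : R) :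
  0 < r -> r < s -> 0 < e -> 0 < L ->
  (forall x, euclid_norm x < s -> {for x, continuous v}) ->
  (forall x, euclid_norm x < s -> `|v x| <= M) ->
  (forall x, euclid_norm x < r -> exists2 l, `|l| <= L & lap_at v x l) ->
  exists2 h, mlap h = 0 &
    forall x, euclid_norm x <= r -> `|v x - ev h x| <= e + L * r ^+ 2.
Proof.
move=> r0 rs e0 L0 cv vM lv.
have [p hp] := weierstrass r0 rs e0 cv vM.
have [h h0 hb] := dirichlet n_gt0 p r0.
exists h => // x xr.
have cvx y : euclid_norm y <= r -> {for y, continuous v}.
  by move=> yr; apply: cv; exact: le_lt_trans rs.
have lh y : lap_at (fun z => ev h z) y 0.
  by have := lap_at_poly h y; rewrite h0 meval0.
rewrite ler_norml; apply/andP; split.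
- suff : ev h x - v x <= e + L * r ^+ 2 by lra.
  apply: (max_principle n_gt0 (w := fun y => ev h y - v y) L0) xr.
  + by move=> y yr; apply: continuousB; [exact: continuous_ev|exact: cvx].
  + move=> y yr; have [l Ll hl] := lv _ yr; exists (0 - l); last exact: lap_atB.
    by move: Ll; rewrite ler_norml => /andP[]; lra.
  + move=> y yr; have := hp y; rewrite yr lexx hb// => /(_ isT).
    by rewrite ler_norml => /andP[]; lra.
- apply: (max_principle n_gt0 (w := fun y => v y - ev h y) L0) xr.
  + by move=> y yr; apply: continuousB; [exact: cvx|exact: continuous_ev].
  + move=> y yr; have [l Ll hl] := lv _ yr; exists (l - 0); last exact: lap_atB.
    by move: Ll; rewrite ler_norml => /andP[]; lra.
  + move=> y yr; have := hp y; rewrite yr lexx hb// => /(_ isT).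
    by rewrite ler_norml => /andP[]; lra.
Qed.

End Weierstrass.

(** * From C^2 functions to continuity and second differences *)

Section Regularity.
Variables (R : realType) (n : nat).
Implicit Types (x y z : 'rV[R]_n) (u : 'rV[R]_n -> R) (A : set 'rV[R]_n).

Lemma mvt_norm (g dg : R -> R) (c B : R) :
  (forall t : R, `|t| <= `|c| -> is_derive t 1 g (dg t)) ->
  (forall t : R, `|t| <= `|c| -> `|dg t| <= B) ->
  `|g c - g 0| <= B * `|c|.
Proof.
move=> hg hB.
have main a b : (forall t, t \in `[a, b] -> `|t| <= `|c|) -> a < b ->
    `|g b - g a| <= B * `|b - a|.
  move=> sub ab.
  have d1 t : t \in `]a, b[ -> is_derive t 1 g (dg t).
    by move=> tab; apply/hg/sub; exact: subset_itv_oo_cc.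
  have c1 : {within `[a, b], continuous g}.
    apply: derivable_within_continuous => t tab.
    exact: (@ex_derive _ _ _ _ _ _ _ (hg _ (sub _ tab))).
  have [t tab ->] := MVT ab d1 c1.
  by rewrite normrM ler_wpM2r// hB// sub//; exact: subset_itv_oo_cc.
have [c0|c0|->] := ltgtP c 0; last by rewrite subrr !normr0 mulr0.
- rewrite distrC (_ : `|c| = `|0 - c|); last by rewrite sub0r normrN.
  apply: main => // t; rewrite in_itv/= => /andP[ct t0].
  by rewrite !ler0_norm//; lra.
- rewrite -[in leRHS](subr0 c); apply: main => // t; rewrite in_itv/= => /andP[t0 tc].
  by rewrite !ger0_norm//; lra.
Qed.

(** The function g(s) + g(-s) - a s^2 has derivative h(s) - h(-s) - 2 a s = o(s), as h has
    derivative a at 0; by the mean value theorem it varies by o(t^2) between 0 and t. *)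
Lemma sdq_cvg (g h : R -> R) (a d : R) : 0 < d ->
  (forall t : R, `|t| < d -> is_derive t 1 g (h t)) -> is_derive (0 : R) 1 h a ->
  (fun t : R => (g t + g (- t) - 2 * g 0) / t ^+ 2) @ 0^' --> a.
Proof.
move=> d0 hg [hd hv]; apply/cvgrPdist_le => e' e'0.
pose e := e' / 2; have e0 : 0 < e by rewrite divr_gt0.
have /cvgrPdist_le/(_ e e0) :
    (fun t : R => t^-1 *: ((h \o shift 0) (t *: 1) - h 0)) @ 0^' --> a.
  by rewrite -hv; exact: hd.
rewrite near_withinE => /nbhs_ballP[d1 /= d10 hd1].
have he s : `|s| < d1 -> `|h s - h 0 - a * s| <= e * `|s|.
  move=> sd; have [->|s0] := eqVneq s 0; first by rewrite subrr mulr0 subr0 !normr0 mulr0.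
  have := hd1 s; rewrite -ball_normE /ball_/= sub0r normrN => /(_ sd s0).
  rewrite addr0 [_ *: 1]mulr1 => H.
  have -> : h s - h 0 - a * s = - (a - s^-1 * (h s - h 0)) * s.
    by rewrite mulNr mulrBl mulrAC mulVf// mul1r opprB.
  by rewrite normrM normrN ler_wpM2r.
near=> t.
have t0 : t != 0 by near: t; exact: nbhs_dnbhs_neq.
have td : `|t| < d by near: t; exact: dnbhs0_lt.
have td1 : `|t| < d1 by near: t; exact: dnbhs0_lt.
pose k s := g s + g (- s) - a * s ^+ 2.
have dk (s : R) : `|s| <= `|t| -> is_derive s 1 k (h s - h (- s) - a * (2 * s)).
  move=> st; have sd := le_lt_trans st td.
  have d1' := hg s sd.
  have d2 : is_derive s 1 (g \o -%R) (h (- s) * -1).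
    have gN : is_derive (- s) 1 g (h (- s)) by apply: hg; rewrite normrN.
    exact: is_derive1_comp.
  have d3 : is_derive s 1 (fun s : R => a * s ^+ 2) (a * (2 * s)).
    by apply: is_derive_eq; rewrite /GRing.scale/=; ring.
  have -> : k = (g + (g \o -%R)) - (fun s => a * s ^+ 2) by [].
  by apply: is_derive_eq; rewrite mulrN1.
have bk (s : R) : `|s| <= `|t| -> `|h s - h (- s) - a * (2 * s)| <= 2 * e * `|t|.
  move=> st; have s1 := he s (le_lt_trans st td1).
  have := he (- s); rewrite normrN => /(_ (le_lt_trans st td1)).
  have -> : h s - h (- s) - a * (2 * s) =
    (h s - h 0 - a * s) - (h (- s) - h 0 - a * - s) by ring.
  move=> s2; apply: le_trans (ler_normB _ _) _.
  by have : e * `|s| <= e * `|t|; [rewrite ler_wpM2l// ltW|lra].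
have := mvt_norm dk bk.
have -> : k t - k 0 = - (a - (g t + g (- t) - 2 * g 0) / t ^+ 2) * t ^+ 2.
  by rewrite /k oppr0; field.
have t2 : 0 < `|t| ^+ 2 by rewrite exprn_gt0// normr_gt0.
rewrite normrM normrN normrX => H; rewrite -(ler_pM2r t2); apply: le_trans H _.
rewrite (_ : 2 * e * `|t| * `|t| = e' * `|t| ^+ 2)// /e; field.
Unshelve. all: by end_near. Qed.

Lemma is_derive_line u x i (t : R) : derivable u (x + t *: e_ i) (e_ i) ->
  is_derive t 1 (fun s : R => u (x + s *: e_ i)) (partial i u (x + t *: e_ i)).
Proof.
move=> du.
have E : (fun h : R => h^-1 *: (((fun s : R => u (x + s *: e_ i)) \o shift t) (h *: 1)
      - u (x + t *: e_ i))) =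
    (fun h : R => h^-1 *: ((u \o shift (x + t *: e_ i)) (h *: e_ i) - u (x + t *: e_ i))).
  apply/funext => h /=; congr (_ *: (u _ - _)).
  by rewrite [h *: 1]mulr1 scalerDl addrCA.
by split; rewrite /partial ?/derivable ?/derive E.
Qed.

Lemma mx_norm_le x (c : R) : 0 <= c -> (forall i, `|x ord0 i| <= c) -> `|x| <= c.
Proof.
move=> c0 h; rewrite [leLHS]/Num.norm/= mx_normrE.
by apply/bigmax_leP; split=> [//|[i j] _ /=]; rewrite ord1.
Qed.

(** [C1_on] asks for continuous partial derivatives and not for continuity of [u]. These derivatives
    are bounded by [K] near x, and y is reached from x by changing one coordinate at a time, with
    the mean value theorem on each step. *)
Lemma C1_continuous A u x : C1_on A u -> nbhs x A -> {for x, continuous u}.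
Proof.
move=> uA xA.
pose K := \sum_i (`|partial i u x| + 1).
have near_u : \forall y \near x, A y /\ forall i, `|partial i u y| <= K.
  suff h1 : \forall y \near x, forall i, `|partial i u y| <= K.
    by near=> y; split; near: y.
  apply: (@filter_forall _ 'I_n (fun i y => `|partial i u y| <= K) (nbhs x) _) => i.
  have [_ ci] := uA x (nbhs_singleton xA) i.
  have : \forall y \near x, `|partial i u x - partial i u y| < 1.
    exact: (@cvgr_dist_lt _ _ _ (nbhs x) _ (partial i u) (partial i u x)).
  apply: filterS => y h; rewrite /K (bigD1 i)//=.
  have : 0 <= \sum_(j < n | j != i) (`|partial j u x| + 1).
    by apply: sumr_ge0 => j _; rewrite addr_ge0.
  have : `|partial i u y| <= `|partial i u x| + `|partial i u x - partial i u y|.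
    by rewrite -{1}[partial i u y](subKr (partial i u x)) ler_normB.
  lra.
have /nbhs_ballP[d /= d0 hd] := near_u.
have K0 : 0 <= K by apply: sumr_ge0 => j _; rewrite addr_ge0.
have step y : `|y - x| < d -> `|u y - u x| <= n%:R * (K * `|y - x|).
  move=> yd.
  (* A staircase from x to y. It stays in the ball of radius |y - x| around x because the norm is
     the sup norm. *)
  pose z k : 'rV[R]_n := \row_(j < n) (if (j < k)%N then y ord0 j else x ord0 j).
  have z0 : z 0%N = x by apply/rowP => j; rewrite mxE.
  have zn : z n = y by apply/rowP => j; rewrite mxE ltn_ord.
  rewrite -{1}zn -{1}z0 -(telescope_sumr (fun k => u (z k)) (leq0n n)) big_mkord.
  apply: le_trans (ler_norm_sum _ _ _) _.
  have -> : n%:R * (K * `|y - x|) = \sum_(i < n) K * `|y - x|.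
    by rewrite sumr_const card_ord mulr_natl.
  apply: ler_sum => i _.
  set c := y ord0 i - x ord0 i.
  have ci : `|c| <= `|y - x| by have := coord_le_mx_norm (y - x) i; rewrite !mxE.
  have zi : z i.+1 = z i + c *: e_ i.
    apply/rowP => j; rewrite !mxE ltnS leq_eqVlt eqxx/= /c.
    have [->|ji] := eqVneq j i; first by rewrite eqxx ltnn /=; ring.
    by rewrite mulr0 addr0 val_eqE (negbTE ji).
  have inA t : `|t| <= `|c| -> A (z i + t *: e_ i) /\
      forall i', `|partial i' u (z i + t *: e_ i)| <= K.
    move=> tc; apply: hd; rewrite -ball_normE/= distrC.
    apply: le_lt_trans yd; apply: mx_norm_le => // j; rewrite !mxE eqxx/=.
    have [->|ji] := eqVneq j i.
      by rewrite ltnn mulr1 addrAC subrr add0r; exact: le_trans tc ci.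
    rewrite mulr0 addr0; case: ifP => _; last by rewrite subrr normr0.
    by have := coord_le_mx_norm (y - x) j; rewrite !mxE.
  apply: (@le_trans _ _ (K * `|c|)); last by rewrite ler_wpM2l.
  have -> : u (z i) = u (z i + 0 *: e_ i) by rewrite scale0r addr0.
  rewrite zi; apply: (@mvt_norm (fun t => u (z i + t *: e_ i))
    (fun t => partial i u (z i + t *: e_ i))) => t tc.
    by apply: is_derive_line; have [/uA/(_ i)[]] := inA t tc.
  by have [_] := inA t tc.
apply/(@cvgrPdist_lt _ _ _ (nbhs x) _ u (u x)) => e e0.
have nK : 0 < n%:R * K + 1 by rewrite ltr_wpDl// mulr_ge0.
near=> y.
have yx : `|y - x| < Num.min d (e / (n%:R * K + 1)).
  rewrite distrC; near: y.
  apply: (@cvgr_dist_lt _ _ _ (nbhs x) _ id x) => //.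
  by rewrite lt_min d0 divr_gt0.
move: yx; rewrite lt_min => /andP[yd]; rewrite ltr_pdivlMr// => ye.
rewrite distrC; apply: le_lt_trans (step _ yd) _.
by apply: le_lt_trans ye; have := normr_ge0 (y - x); nra.
Unshelve. all: by end_near. Qed.

(** Second differences along each axis tie the Laplacian of the statement to the one of the maximum
    principle. *)
Lemma C2_lap_at A u x : open A -> A x -> C2_on A u -> lap_at u x (laplacian u x).
Proof.
move=> oA Ax [u1 u2]; rewrite /lap_at /laplacian.
apply: cvg_big => // [|i _]; first exact: add_continuous.
have /nbhs_ballP[d /= d0 hd] : nbhs x A by apply: open_nbhs_nbhs.
have inA (t : R) : `|t| < d -> A (x + t *: e_ i).
  move=> td; apply: hd; rewrite -ball_normE/= opprD addrA subrr sub0r normrN.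
  apply: le_lt_trans (mx_norm_le_euclid_norm _) _.
  by rewrite euclid_normZ euclid_norm_delta mulr1.
have h1 (t : R) : `|t| < d ->
    is_derive t 1 (fun s : R => u (x + s *: e_ i)) (partial i u (x + t *: e_ i)).
  by move=> /inA/u1/(_ i)[+ _]; exact: is_derive_line.
have h2 : is_derive (0 : R) 1 (fun s : R => partial i u (x + s *: e_ i))
    (partial i (partial i u) x).
  have [+ _] := u2 i x Ax i; rewrite -{1}[x]addr0 -(scale0r (e_ i)) => /is_derive_line.
  by rewrite scale0r addr0.
have := sdq_cvg d0 h1 h2; rewrite /= scale0r addr0.
by under eq_fun do rewrite scaleNr.
Qed.

Lemma open_euclid_ball (r : R) : open (@euclid_ball R n r).
Proof.
rewrite openE => x xr; have d0 : 0 < r - euclid_norm x by rewrite subr_gt0.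
have := near_euclid_norm x d0; apply: filterS => y yx.
rewrite /euclid_ball/= -[y](subrK x); apply: le_lt_trans (euclid_normD _ _) _; lra.
Qed.

End Regularity.

(** * Summation over dyadic radii *)

Section Dyadic.
Variables (R : realType) (n : nat).
Implicit Types (x y : 'rV[R]_n) (p : mpoly n R) (b : multinom n).

(** With B = K / (1 - mu), the intervals of centre a_j and radius B mu^j are nested, since B mu^j -
    B mu^(j+1) = K mu^j; the limit is the supremum of their lower ends. *)
Lemma geometric_limit (a : nat -> R) (K mu : R) : 0 <= mu < 1 ->
  (forall j, `|a j.+1 - a j| <= K * mu ^+ j) ->
  exists l, forall j, `|l - a j| <= K / (1 - mu) * mu ^+ j.
Proof.
move=> /andP[mu0 mu1] ha.
have K0 : 0 <= K by have := ha 0%N; rewrite expr0 mulr1; exact: le_trans.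
pose B := K / (1 - mu).
have B0 : 0 <= B by rewrite divr_ge0// subr_ge0 ltW.
have BK : B - B * mu = K by rewrite /B; field; rewrite subr_eq0 gt_eqF.
pose lo j := a j - B * mu ^+ j; pose up j := a j + B * mu ^+ j.
have KB j : K * mu ^+ j = B * mu ^+ j - B * mu ^+ j.+1.
  by rewrite exprS mulrA -mulrBl BK.
have lo_nd : {homo lo : i j / (i <= j)%N >-> i <= j}.
  apply: homo_leq => [|x y z|j]; [exact: lexx|exact: le_trans|].
  by have := ha j; rewrite ler_norml KB /lo => /andP[]; lra.
have up_ni : {homo up : i j / (i <= j)%N >-> j <= i}.
  apply: homo_leq => [|y x z|j]; [exact: lexx|by move=> h1 h2; exact: le_trans h2 h1|].
  by have := ha j; rewrite ler_norml KB /up => /andP[]; lra.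
have lo_up i j : lo i <= up j.
  apply: (@le_trans _ _ (lo (maxn i j))); first by rewrite lo_nd// leq_maxl.
  apply: (@le_trans _ _ (up (maxn i j))); last by rewrite up_ni// leq_maxr.
  by have : 0 <= B * mu ^+ maxn i j; [rewrite mulr_ge0// exprn_ge0|rewrite /lo /up; lra].
exists (sup (range lo)) => j; rewrite ler_norml; apply/andP; split.
  have : lo j <= sup (range lo).
    apply: ub_le_sup; last by exists j.
    by exists (up 0%N) => _ [i _ <-]; exact: lo_up.
  by rewrite /lo -/B; lra.
have : sup (range lo) <= up j.
  by apply: ge_sup; [exists (lo 0%N); exists 0%N|move=> _ [i _ <-]; exact: lo_up].
by rewrite /up -/B; lra.
Qed.

Lemma geometric_sum_le (nu : R) J : 1 < nu -> \sum_(j < J) nu ^+ j <= nu ^+ J / (nu - 1).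
Proof.
move=> nu1; have d0 : 0 < nu - 1 by rewrite subr_gt0.
rewrite ler_pdivlMr// mulrC -subrX1; lra.
Qed.

Lemma norm_ev_monomial b x : `|ev (mpolyX R b) x| <= euclid_norm x ^+ mdeg b.
Proof.
rewrite mevalX normr_prod mdegE -prodrXr; apply: ler_prod => i _.
rewrite normr_ge0 normrX lerXn2r ?nnegrE ?euclid_norm_ge0//.
exact: coord_le_euclid_norm.
Qed.

Lemma ev_deg_lt k p x : deg_lt k p ->
  ev p x = \sum_(b : bmultinom n k) mcoeff (bmnm b) p * ev (mpolyX R (bmnm b)) x.
Proof.
move=> /deg_ltP pk; rewrite {1}(mpolywE pk) ev_sum.
by apply: eq_bigr => b _; rewrite mevalZ.
Qed.

Lemma ev_deg_lt_le k p (K : R) x : deg_lt k p -> (forall b, `|mcoeff b p| <= K) ->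
  euclid_norm x <= 1 -> `|ev p x| <= #|{: bmultinom n k}|%:R * K.
Proof.
move=> pk pK x1; rewrite (ev_deg_lt _ pk) mulr_natl -sumr_const.
apply: le_trans (ler_norm_sum _ _ _) _; apply: ler_sum => b _.
have K0 : 0 <= K by exact: le_trans (pK (bmnm b)).
rewrite normrM -[leRHS]mulr1; apply: ler_pM => //.
apply: le_trans (norm_ev_monomial _ _) _.
by rewrite exprn_ile1 ?euclid_norm_ge0.
Qed.

Lemma harmonic_coef_le (n_gt0 : (0 < n)%N) d : exists2 C : R, 0 <= C &
  forall p (r M : R) b, 0 < r -> mlap p = 0 ->
  (forall x, euclid_norm x <= r -> `|ev p x| <= M) -> (mdeg b <= d)%N ->
  `|mcoeff b p| <= C * M / r ^+ mdeg b.
Proof.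
have [Cf hC] := choice (fun k => iffLR (exists2P _ _) (harmonic_coef R n_gt0 k)).
exists (\sum_(k < d.+1) Cf k); first by apply: sumr_ge0 => k _; exact: (hC k).1.
move=> p r M b r0 hp pM bd.
have M0 : 0 <= M.
  by apply: le_trans (pM 0 _); rewrite ?normr_ge0// euclid_norm0 ltW.
apply: le_trans ((hC (mdeg b)).2 _ _ _ _ r0 hp pM erefl) _.
rewrite ler_wpM2r ?invr_ge0 ?exprn_ge0 ?(ltW r0)// ler_wpM2r//.
have bd' : (mdeg b < d.+1)%N by [].
by rewrite (bigD1 (Ordinal bd'))//= lerDl sumr_ge0// => k _; exact: (hC k).1.
Qed.

(** Consecutive approximants differ by O(tau^j) on the radius r_(j+1). The coefficients of degree m
    of the difference are O((tau 2^m)^j), summable for m <= d. Its remainder of order d + 1, taken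
    well inside the radius r_J, is O(nu^j 2^(-J(d+1))) with nu = tau 2^(d+1) > 1, and the sum of
    these over j < J is O(tau^J). *)
Lemma dyadic_expansion (n_gt0 : (0 < n)%N) d (r0 tau : R) :
  0 < r0 <= 1 -> 0 < tau -> tau * 2 ^+ d < 1 -> 1 < tau * 2 ^+ d.+1 ->
  exists2 C : R, 0 <= C & forall (v : 'rV[R]_n -> R) (E : R), 0 <= E ->
  (forall j, exists2 h, mlap h = 0 &
     forall x, euclid_norm x <= r0 / 2 ^+ j -> `|v x - ev h x| <= E * tau ^+ j) ->
  (forall x, euclid_norm x <= r0 -> `|v x| <= E) ->
  exists p, [/\ deg_lt d.+1 p, forall b, `|mcoeff b p| <= C * E &
    forall J x, euclid_norm x <= r0 / 2 ^+ (J + d.+2) ->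
      `|v x - ev p x| <= C * E * tau ^+ J].
Proof.
move=> /andP[r0_gt0 r0_le1] tau0 tau_d tau_d1.
have [Cc Cc0 hCc] := harmonic_coef_le n_gt0 d.
have [Ct Ct0 hCt] := harmonic_tail R n_gt0 d.+1.
have p2 k : 0 < 2 ^+ k :> R by rewrite exprn_gt0.
have tau1 : tau <= 1.
  have : 1 <= 2 ^+ d :> R by rewrite exprn_ege1// ler1n.
  by move=> h; apply: le_trans (ltW tau_d); rewrite ler_peMr// ltW.
have tauX k : 0 <= tau ^+ k by rewrite exprn_ge0// ltW.
have r0V : 1 <= 2 / r0 by rewrite ler_pdivlMr//; lra.
(* As 2 / r0 >= 1, its power d serves all degrees up to d. *)
pose K1 := 2 * Cc * (2 / r0) ^+ d.
have K10 : 0 <= K1 by rewrite !mulr_ge0// exprn_ge0// (le_trans _ r0V).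
pose K2 := K1 / (1 - tau * 2 ^+ d).
have K20 : 0 <= K2 by rewrite divr_ge0// subr_ge0 ltW.
pose nu := tau * 2 ^+ d.+1.
have nu1 : 0 < nu - 1 by rewrite subr_gt0.
(* The 1 accounts for the remainder of [H 0], the other term for those of the differences [D j]. *)
pose K3 := 2 * Ct * (1 + 2 ^+ d.+1 / (nu - 1)).
have K30 : 0 <= K3.
  by rewrite !mulr_ge0// addr_ge0// divr_ge0// ltW.
pose N : R := #|{: bmultinom n d.+1}|%:R.
have N0 : 0 <= N by exact: ler0n.
exists (1 + K3 + N * K2 + K1 + K2).
  by rewrite !addr_ge0// mulr_ge0.
move=> v E E0 happrox vE.
have [H hH] := choice (fun j => iffLR (exists2P _ _) (happrox j)).
have rj j : 0 < r0 / 2 ^+ j by rewrite divr_gt0.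
have rj1 j x : euclid_norm x <= r0 / 2 ^+ j.+1 -> euclid_norm x <= r0 / 2 ^+ j.
  move=> h; apply: le_trans h _; rewrite ler_pM2l// lef_pV2 ?posrE//.
  by rewrite exprS ler_peMl ?ler1n// ltW.
pose D j := H j.+1 - H j.
have lapD j : mlap (D j) = 0 by rewrite mlapB (hH _).1 (hH _).1 subrr.
have bndD j x : euclid_norm x <= r0 / 2 ^+ j.+1 -> `|ev (D j) x| <= 2 * E * tau ^+ j.
  move=> xr; rewrite mevalB.
  have -> : ev (H j.+1) x - ev (H j) x = (v x - ev (H j) x) - (v x - ev (H j.+1) x) by ring.
  apply: le_trans (ler_normB _ _) _.
  have h1 := (hH j).2 _ (rj1 _ _ xr); have h2 := (hH j.+1).2 _ xr.
  have : E * tau ^+ j.+1 <= E * tau ^+ j.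
    by rewrite ler_wpM2l// exprS ler_piMl.
  lra.
have bnd0 x : euclid_norm x <= r0 -> `|ev (H 0%N) x| <= 2 * E.
  move=> xr; have := (hH 0%N).2 x; rewrite expr0 divr1 mulr1 => /(_ xr).
  move=> h2; have -> : ev (H 0%N) x = v x - (v x - ev (H 0%N) x) by ring.
  by apply: le_trans (ler_normB _ _) _; have := vE _ xr; lra.
have pow_le m : (m <= d)%N -> (2 / r0) ^+ m <= (2 / r0) ^+ d.
  by move=> md; rewrite ler_weXn2l.
have coefD j b : (mdeg b <= d)%N -> `|mcoeff b (H j.+1) - mcoeff b (H j)| <=
    K1 * E * (tau * 2 ^+ mdeg b) ^+ j.
  move=> bd; rewrite -mcoeffB.
  apply: le_trans (hCc _ _ _ _ (rj j.+1) (lapD j) (bndD j) bd) _.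
  have -> : Cc * (2 * E * tau ^+ j) / (r0 / 2 ^+ j.+1) ^+ mdeg b =
      2 * Cc * (2 / r0) ^+ mdeg b * E * (tau * 2 ^+ mdeg b) ^+ j.
    rewrite exprS !exprMn !exprVn -!exprM [(mdeg b * j)%N]mulnC !exprMn -exprM.
    by field; rewrite ?expf_neq0 ?gt_eqF.
  by rewrite ler_wpM2r ?exprn_ge0 ?mulr_ge0 ?(ltW tau0)// ler_wpM2r// ler_wpM2l ?mulr_ge0 ?pow_le.
have coef0 b : (mdeg b <= d)%N -> `|mcoeff b (H 0%N)| <= K1 * E.
  move=> bd; apply: le_trans (hCc _ _ _ _ r0_gt0 (hH 0%N).1 bnd0 bd) _.
  have -> : Cc * (2 * E) / r0 ^+ mdeg b = 2 * Cc * E * (1 / r0) ^+ mdeg b.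
    by rewrite expr_div_n expr1n; ring.
  have -> : K1 * E = 2 * Cc * E * (2 / r0) ^+ d by rewrite /K1; ring.
  rewrite ler_wpM2l ?mulr_ge0//; apply: le_trans (pow_le _ bd).
  by rewrite lerXn2r ?nnegrE ?divr_ge0 ?ler_wpM2r ?invr_ge0 ?(ltW r0_gt0) ?ler1n.
have limit_ex b : exists l, (mdeg b <= d)%N ->
    forall j, `|l - mcoeff b (H j)| <= K2 * E * (tau * 2 ^+ mdeg b) ^+ j.
  have [bd|_] := leqP (mdeg b) d; last by exists 0.
  have mu_d : tau * 2 ^+ mdeg b <= tau * 2 ^+ d.
    by rewrite ler_wpM2l ?(ltW tau0)// ler_weXn2l// ler1n.
  have mu01 : 0 <= tau * 2 ^+ mdeg b < 1.
    by rewrite mulr_ge0 ?(ltW tau0)//= (le_lt_trans mu_d).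
  have [l hl] := geometric_limit mu01 (fun j => coefD j b bd).
  exists l => _ j; apply: le_trans (hl j) _.
  rewrite ler_wpM2r ?exprn_ge0 ?mulr_ge0 ?(ltW tau0)// /K2 mulrAC.
  rewrite ler_wpM2r// ler_wpM2l// lef_pV2 ?posrE; lra.
have [a ha] := choice limit_ex.
pose p : mpoly n R := \sum_(b : bmultinom n d.+1) a (bmnm b) *: mpolyX R (bmnm b).
have coefp b : (mdeg b <= d)%N -> mcoeff b p = a b.
  by move=> bd; rewrite /p mcoeff_mpoly.
have degp : deg_lt d.+1 p.
  apply: deg_lt_sum => b; apply: deg_ltZ => c dc; rewrite mcoeffX.
  by case: eqP => // bc; have := bmdeg b; rewrite bc ltnNge dc.
exists p; split=> //.
  move=> b; have [bd|db] := leqP (mdeg b) d; last first.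
    by rewrite degp// normr0 mulr_ge0// !addr_ge0// mulr_ge0.
  rewrite coefp//; have := ha b bd 0%N; rewrite expr0 mulr1 => h1.
  have h2 := coef0 b bd.
  have -> : a b = (a b - mcoeff b (H 0%N)) + mcoeff b (H 0%N) by rewrite subrK.
  apply: le_trans (ler_normD _ _) _.
  have : 0 <= (1 + K3 + N * K2) * E by rewrite mulr_ge0// !addr_ge0// mulr_ge0.
  lra.
move=> J x xJ.
have xJ' : euclid_norm x <= r0 / 2 ^+ J.
  apply: le_trans xJ _; rewrite ler_pM2l// lef_pV2 ?posrE// exprD.
  by rewrite ler_peMr ?(ltW (p2 _))// exprn_ege1// ler1n.
(* Telescoping: H i is H 0 plus the D j with j < i. The extra factor 2^-(d+2) in the radius puts x
   where [harmonic_tail] applies to each of them. *)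
have tailH i : (i <= J)%N -> `|ev (mtail d.+1 (H i)) x| <=
    2 * Ct * E / 2 ^+ (J * d.+1) * (1 + 2 ^+ d.+1 * \sum_(j < i) nu ^+ j).
  elim: i => [_|i IH iJ].
    rewrite big_ord0 mulr0 addr0 mulr1.
    have xd : euclid_norm x <= r0 / 2 ^+ d.+1.
      apply: le_trans xJ _; rewrite ler_pM2l// lef_pV2 ?posrE// ler_weXn2l ?ler1n//.
      by rewrite -addSnnS leq_addl.
    apply: le_trans (hCt _ _ _ r0_gt0 (hH 0%N).1 bnd0 _ xd) _.
    rewrite [leRHS](_ : _ = Ct * (2 * E) * (2 ^+ J)^-1 ^+ d.+1); last first.
      by rewrite exprVn exprM; ring.
    rewrite ler_wpM2l ?mulr_ge0// lerXn2r ?nnegrE ?divr_ge0 ?invr_ge0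
      ?euclid_norm_ge0 ?(ltW r0_gt0) ?(ltW (p2 _))//.
    by rewrite ler_pdivrMr// mulrC.
  have -> : H i.+1 = H i + D i by rewrite /D addrC subrK.
  rewrite mtailD mevalD; apply: le_trans (ler_normD _ _) _.
  rewrite big_ord_recr/=; set c := _ / _; set S := \sum_(j < i) _.
  rewrite [leRHS](_ : _ = c * (1 + 2 ^+ d.+1 * S) + c * (2 ^+ d.+1 * nu ^+ i)); last by ring.
  apply: lerD; first exact: IH (ltnW iJ).
  have xd : euclid_norm x <= r0 / 2 ^+ i.+1 / 2 ^+ d.+1.
    apply: le_trans xJ _; rewrite -mulrA ler_pM2l// -invfM lef_pV2 ?posrE ?mulr_gt0//.
    by rewrite -exprD ler_weXn2l ?ler1n// addSnnS leq_add2r ltnW.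
  apply: le_trans (hCt _ _ _ (rj i.+1) (lapD i) (bndD i) _ xd) _.
  rewrite [leRHS](_ : _ = Ct * (2 * E * tau ^+ i) * (2 ^+ i.+1 / 2 ^+ J) ^+ d.+1); last first.
    rewrite /c /nu [2 ^+ i.+1]exprS !exprMn exprVn -!exprM [(d.+1 * i)%N]mulnC.
    by field; rewrite ?expf_neq0.
  rewrite ler_wpM2l ?mulr_ge0// lerXn2r ?nnegrE ?divr_ge0 ?euclid_norm_ge0
    ?(ltW r0_gt0) ?(ltW (p2 _))//.
  rewrite ler_pdivrMr//; apply: le_trans xJ' _.
  by rewrite le_eqVlt; apply/orP; left; apply/eqP; field; rewrite !expf_neq0.
have tailJ : `|ev (mtail d.+1 (H J)) x| <= K3 * E * tau ^+ J.
  apply: le_trans (tailH J (leqnn J)) _.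
  have -> : tau ^+ J = nu ^+ J / 2 ^+ (J * d.+1).
    by rewrite /nu exprMn -exprM mulnC; field; rewrite expf_neq0.
  rewrite [leRHS](_ : _ = 2 * Ct * E / 2 ^+ (J * d.+1) *
      (nu ^+ J + 2 ^+ d.+1 * (nu ^+ J / (nu - 1)))); last first.
    by rewrite /K3; field; rewrite expf_neq0// gt_eqF.
  rewrite ler_wpM2l ?divr_ge0 ?mulr_ge0// ?(ltW (p2 _))//.
  apply: lerD; first by rewrite exprn_ege1// ltW.
  by rewrite ler_wpM2l ?(ltW (p2 _))// geometric_sum_le.
(* A coefficient of degree m is off by O((tau 2^m)^J) and its monomial is at most 2^(-Jm): each term
   is O(tau^J). *)
have lowJ : `|ev (H J - mtail d.+1 (H J) - p) x| <= N * (K2 * E * tau ^+ J).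
  have dl : deg_lt d.+1 (H J - mtail d.+1 (H J) - p).
    by move=> b db; rewrite !mcoeffB mcoeff_mtail db subrr degp// subrr.
  rewrite (ev_deg_lt _ dl) /N mulr_natl -sumr_const.
  apply: le_trans (ler_norm_sum _ _ _) _; apply: ler_sum => b _.
  have bd : (mdeg (bmnm b) <= d)%N by have := bmdeg b.
  rewrite !mcoeffB mcoeff_mtail ltnNge bd/= subr0 coefp// normrM distrC.
  rewrite [leRHS](_ : _ = K2 * E * (tau * 2 ^+ mdeg (bmnm b)) ^+ J *
      (1 / 2 ^+ J) ^+ mdeg (bmnm b)); last first.
    rewrite !exprMn exprVn -!exprM [(mdeg _ * J)%N]mulnC expr1n.
    by field; rewrite expf_neq0.
  apply: ler_pM => //; first exact: ha.
  apply: le_trans (norm_ev_monomial _ _) _.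
  rewrite lerXn2r ?nnegrE ?divr_ge0 ?euclid_norm_ge0 ?(ltW (p2 _))//.
  by apply: le_trans xJ' _; rewrite ler_wpM2r// invr_ge0 ltW.
have -> : v x - ev p x = (v x - ev (H J) x) + ev (mtail d.+1 (H J)) x +
    ev (H J - mtail d.+1 (H J) - p) x by rewrite !mevalB; ring.
apply: le_trans (ler_normD _ _) _.
have := ler_normD (v x - ev (H J) x) (ev (mtail d.+1 (H J)) x).
have := (hH J).2 _ xJ'.
have : 0 <= (K1 + K2) * E * tau ^+ J by rewrite !mulr_ge0// addr_ge0.
lra.
Qed.

End Dyadic.

(** * The pointwise estimate at the origin *)

Section Schauder.
Variables (R : realType) (n : nat).
Implicit Types (x y : 'rV[R]_n) (p : mpoly n R) (b : multinom n).

Lemma powR_lt1 (a x : R) : 0 < a < 1 -> 0 < x -> a `^ x < 1.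
Proof.
move=> /andP[a0 a1] x0; rewrite (_ : 1 = 1 `^ x); last by rewrite powR1.
by apply: gt0_ltr_powR => //; rewrite nnegrE ltW.
Qed.

Lemma exprn_small (t e : R) : 0 <= t < 1 -> 0 < e -> exists J, t ^+ J < e.
Proof.
move=> /andP[t0 t1] e0.
have : t ^+ J @[J --> \oo] --> (0 : R) by apply: cvg_expr; rewrite ger0_norm.
move=> /cvgr_lt/(_ e e0) h; near \oo => J; exists J; near: J; exact: h.
Unshelve. all: by end_near. Qed.

(** For the least J with rho / 2^(J+1) < |x|, tau^J = (2^-J)^s <= (2 |x| / rho)^s, whence the
    constant. *)
Lemma expansion_of_dyadic (rho s : R) : 0 < rho <= 1 -> 0 < s ->
  exists2 C : R, 0 <= C & forall (w : 'rV[R]_n -> R) (K d : R), 0 <= K -> d <= 1 ->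
    (forall x, euclid_norm x < d -> `|w x| <= K) ->
    (forall J x, euclid_norm x <= rho / 2 ^+ J -> `|w x| <= K * (2^-1 `^ s) ^+ J) ->
    forall x, euclid_norm x < d -> `|w x| <= C * K * euclid_norm x `^ s.
Proof.
move=> /andP[rho0 rho1] s0.
pose c := (rho / 2) `^ s.
have c0 : 0 < c by rewrite powR_gt0// divr_gt0.
exists c^-1; first by rewrite invr_ge0 ltW.
move=> w K d K0 d1 wK wJ x xd.
have h01 : 0 < (2^-1 : R) < 1 by apply/andP; split; lra.
pose tau : R := 2^-1 `^ s.
have tau01 : 0 <= tau < 1 by rewrite powR_ge0 powR_lt1.
have tauE J : tau ^+ J = (2^-1 ^+ J) `^ s.
  have h2 : 0 <= 2^-1 :> R by lra.
  by rewrite -[LHS]powR_mulrn ?powR_ge0// /tau powRAC powR_mulrn.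
(* At x = 0 the right-hand side is 0: the bounds for all J force w to vanish there. *)
have [x0|x0] := eqVneq (euclid_norm x) 0.
  rewrite x0 powR0 ?gt_eqF// mulr0 leNgt; apply/negP => wx.
  have K1 : 0 < K + 1 by lra.
  have [J hJ] := exprn_small tau01 (divr_gt0 wx K1).
  have : `|w x| <= K * tau ^+ J.
    by apply: wJ; rewrite x0 divr_ge0 ?exprn_ge0// ltW.
  move: hJ; rewrite ltr_pdivlMr// => hJ.
  have : 0 <= tau ^+ J by rewrite exprn_ge0//; have /andP[] := tau01.
  nra.
have {}x0 : 0 < euclid_norm x by rewrite lt0r x0 euclid_norm_ge0.
have key J : rho / 2 ^+ J.+1 < euclid_norm x -> `|w x| <= K * tau ^+ J ->
    `|w x| <= c^-1 * K * euclid_norm x `^ s.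
  move=> xJ h; apply: le_trans h _; rewrite [_ * K]mulrC -mulrA ler_wpM2l//.
  rewrite mulrC ler_pdivlMr// tauE /c -powRM ?divr_ge0 ?exprn_ge0 ?invr_ge0 ?(ltW rho0)//.
  apply: ge0_ler_powR; rewrite ?nnegrE ?mulr_ge0 ?divr_ge0 ?exprn_ge0 ?invr_ge0
    ?(ltW rho0) ?(ltW x0) ?(ltW s0)//.
  apply: le_trans (ltW xJ); rewrite le_eqVlt; apply/orP; left; apply/eqP.
  by rewrite exprS exprVn; field; rewrite expf_neq0.
have ex : exists J, rho / 2 ^+ J.+1 < euclid_norm x.
  have half01 : 0 <= (2^-1 : R) < 1 by apply/andP; split; lra.
  have [J hJ] := exprn_small half01 (divr_gt0 x0 rho0).
  exists J; rewrite exprS invfM; move: hJ; rewrite ltr_pdivlMr// exprVn.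
  have : 0 < rho * (2 ^+ J)^-1 by rewrite mulr_gt0// invr_gt0 exprn_gt0.
  by rewrite mulrC => h1 h2; rewrite mulrCA; lra.
have exb : exists J, (rho / 2 ^+ J.+1 < euclid_norm x) by [].
(* For J = 0 the point may lie outside the ball of radius rho, and the bound on the whole ball is
   used. Otherwise minimality places x in the next larger dyadic ball. *)
case: (ex_minnP exb) => -[|J] hJ minJ.
  by apply: (key 0%N) => //; rewrite expr0 mulr1 wK.
apply: (key J.+1) => //; apply: wJ; rewrite leNgt; apply/negP => /minJ.
by rewrite ltnn.
Qed.

Lemma pointwise_schauder (n_gt0 : (0 < n)%N) (k : nat) (alpha delta : R) :
  0 < alpha < 1 -> 0 < delta < 1 ->
  exists2 C : R, 0 <= C & forall (v : 'rV[R]_n -> R) (M L : R), 0 <= M -> 0 < L ->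
    (forall x, euclid_norm x < delta ->
       [/\ {for x, continuous v}, `|v x| <= M &
        exists2 l, `|l| <= L * euclid_norm x `^ (k%:R + alpha) & lap_at v x l]) ->
    exists p, [/\ deg_lt k.+3 p, forall b, `|mcoeff b p| <= C * (M + L) &
      forall x, euclid_norm x < delta ->
        `|v x - ev p x| <= C * (M + L) * euclid_norm x `^ (k%:R + alpha + 2)].
Proof.
move=> /andP[al0 al1] /andP[de0 de1].
pose q := k%:R + alpha; pose s := q + 2.
have q0 : 0 < q by rewrite ltr_wpDl.
have s0 : 0 < s by rewrite ltr_wpDr.
pose tau : R := 2^-1 `^ s.
have h2 : 0 < 2^-1 :> R by lra.
have h21 : 2^-1 < 1 :> R by lra.
have tau0 : 0 < tau by rewrite powR_gt0.
have sE : s = k.+2%:R + alpha by rewrite /s /q -addn2 natrD; ring.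
(* With d = k + 2, the two conditions of [dyadic_expansion] on tau read 2^-alpha < 1 and 1 <
   2^(1-alpha). *)
have tau_d : tau * 2 ^+ k.+2 = 2^-1 `^ alpha.
  rewrite /tau sE powRD; last by rewrite (gt_eqF h2) implybT.
  by rewrite powR_mulrn ?(ltW h2)// exprVn mulrAC mulVf ?mul1r// expf_neq0.
have taud1 : tau * 2 ^+ k.+2 < 1 by rewrite tau_d powR_lt1// h2.
have taud2 : 1 < tau * 2 ^+ k.+3.
  rewrite exprS mulrCA tau_d.
  have -> : alpha = 1 - (1 - alpha) by ring.
  rewrite powRB; last by rewrite (gt_eqF h2) implybT.
  have p1 : 2^-1 `^ (1 - alpha) < 1 by rewrite powR_lt1 ?h2 ?subr_gt0.
  rewrite powRr1 ?(ltW h2)// mulrA mulfV// mul1r.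
  by rewrite invf_gt1// powR_gt0.
(* Strictly below delta, because [harmonic_approx] works inside a larger ball where v is continuous
   and bounded. *)
pose r0 := delta / 2.
have r01 : 0 < r0 <= 1 by rewrite /r0; apply/andP; split; lra.
have r0_gt0 : 0 < r0 by case/andP: r01.
have [C1 C10 hC1] := dyadic_expansion n_gt0 r01 tau0 taud1 taud2.
(* k + 4 is d + 2 for d = k + 2, the loss of radius in [dyadic_expansion]. *)
pose rho := r0 / 2 ^+ k.+4.
have rho01 : 0 < rho <= 1.
  rewrite divr_gt0 ?exprn_gt0//= ler_pdivrMr ?exprn_gt0// mul1r.
  apply: (@le_trans _ _ 1); first by case/andP: r01.
  by rewrite exprn_ege1// ler1n.
have [C2 C20 hC2] := expansion_of_dyadic rho01 s0.
pose N : R := #|{: bmultinom n k.+3}|%:R.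
have N0 : 0 <= N by exact: ler0n.
(* [C3 * (M + L)] must dominate M + N C1 E, which bounds |v - p| on the whole ball, and C1 E, which
   serves at the dyadic scales; the 2 comes from E <= 2 (M + L). *)
pose C3 := 2 * (1 + C1 + N * C1).
have C30 : 0 <= C3 by rewrite mulr_ge0// !addr_ge0// mulr_ge0.
exists (2 * C1 + C2 * C3); first by apply: addr_ge0; exact: mulr_ge0.
(* On the radius r the Laplacian contributes L r^q r^2 and the boundary error is taken of the same
   size L r^s, whence 2L; M lets E bound v itself. *)
move=> v M L M0 L0 hv; pose E := M + 2 * L.
have E0 : 0 <= E by rewrite addr_ge0// mulr_ge0// ltW.
have cv x : euclid_norm x < delta -> {for x, continuous v} by move=> /hv[].
have vM x : euclid_norm x < delta -> `|v x| <= M by move=> /hv[].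
have r0d : r0 < delta by rewrite /r0; lra.
have rjle j : r0 / 2 ^+ j <= r0.
  by rewrite ler_pdivrMr ?exprn_gt0// ler_peMr ?(ltW r0_gt0)// exprn_ege1// ler1n.
have happrox j : exists2 h, mlap h = 0 &
    forall x, euclid_norm x <= r0 / 2 ^+ j -> `|v x - ev h x| <= E * tau ^+ j.
  set r := r0 / 2 ^+ j.
  have r_gt0 : 0 < r by rewrite divr_gt0 ?exprn_gt0.
  have rd : r < delta by exact: le_lt_trans (rjle j) r0d.
  have rs0 : 0 < r `^ s by exact: powR_gt0.
  have hl x : euclid_norm x < r -> exists2 l, `|l| <= L * r `^ q & lap_at v x l.
    move=> xr; have [_ _ [l ll hl]] := hv _ (lt_trans xr rd).
    exists l => //; apply: le_trans ll _; rewrite ler_wpM2l ?(ltW L0)//.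
    by apply: ge0_ler_powR; rewrite ?nnegrE ?euclid_norm_ge0 ?(ltW r_gt0) ?(ltW q0) ?(ltW xr).
  have [h h0 hh] := harmonic_approx n_gt0 r_gt0 rd (mulr_gt0 L0 rs0)
    (mulr_gt0 L0 (powR_gt0 q r_gt0)) cv vM hl.
  exists h => // x xr; apply: le_trans (hh x xr) _.
  have -> : L * r `^ q * r ^+ 2 = L * r `^ s.
    rewrite /s (@powRD R r q 2); last by rewrite (gt_eqF r_gt0) implybT.
    by rewrite (@powR_mulrn R r 2) ?(ltW r_gt0)// mulrA.
  have rs : r `^ s <= tau ^+ j.
    rewrite -[leRHS]powR_mulrn ?powR_ge0// /tau powRAC powR_mulrn ?(ltW h2)//.
    apply: ge0_ler_powR; rewrite ?nnegrE ?exprn_ge0 ?(ltW s0) ?(ltW r_gt0) ?(ltW h2)//.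
    rewrite exprVn /r ler_piMl ?invr_ge0 ?exprn_ge0//; by case/andP: r01.
  have t1 : L * r `^ s <= L * tau ^+ j by rewrite ler_wpM2l// ltW.
  have t2 : 0 <= M * tau ^+ j by rewrite mulr_ge0// exprn_ge0// ltW.
  by rewrite /E; lra.
have vE x : euclid_norm x <= r0 -> `|v x| <= E.
  by move=> xr; apply: le_trans (vM _ (le_lt_trans xr r0d)) _; rewrite /E; lra.
have [p [degp coefp hp]] := hC1 v E E0 happrox vE.
have EML : E <= 2 * (M + L) by rewrite /E; lra.
have C1E : C1 * E <= 2 * C1 * (M + L) by have := ler_wpM2l C10 EML; lra.
have ML0 : 0 <= M + L by rewrite addr_ge0// ltW.
exists p; split => //.
  move=> b; apply: le_trans (coefp b) (le_trans C1E _).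
  by rewrite ler_wpM2r// lerDl mulr_ge0.
move=> x xd.
have NC0 : 0 <= N * C1 * E by rewrite !mulr_ge0.
have K0 : 0 <= C3 * (M + L) by rewrite mulr_ge0.
have KE : (1 + C1 + N * C1) * E <= C3 * (M + L).
  have c0 : 0 <= 1 + C1 + N * C1 by rewrite !addr_ge0// mulr_ge0.
  by have := ler_wpM2l c0 EML; rewrite /C3; lra.
apply: (@le_trans _ _ (C2 * (C3 * (M + L)) * euclid_norm x `^ s)); last first.
  rewrite ler_wpM2r ?powR_ge0// mulrA ler_wpM2r// lerDr mulr_ge0//.
apply: (hC2 (fun x => v x - ev p x) _ delta K0 (ltW de1)) => //.
- move=> y yd; apply: le_trans (ler_normB _ _) _.
  have y1 : euclid_norm y <= 1 by exact/ltW/(lt_trans yd).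
  have := ev_deg_lt_le degp coefp y1; rewrite -/N => h.
  have := vM _ yd; have : 0 <= C1 * E by rewrite mulr_ge0.
  have : M <= E by rewrite /E; lra.
  lra.
- move=> J y yJ.
  have yJ' : euclid_norm y <= r0 / 2 ^+ (J + k.+4).
    by apply: le_trans yJ _; rewrite /rho -mulrA -invfM -exprD addnC.
  apply: le_trans (hp J y yJ') _; rewrite ler_wpM2r ?exprn_ge0 ?(ltW tau0)//.
  lra.
Qed.

End Schauder.

(** * From the pointwise estimate to the norms *)

Section Main.
Variables (R : realType) (n : nat).
Implicit Types (x h : 'rV[R]_n) (f u : 'rV[R]_n -> R).

Lemma lap_at_translate u x h (l : R) :
  lap_at u (x + h) l -> lap_at (fun y => u (x + y)) h l.
Proof.
rewrite /lap_at; set F := (F in F @ _ --> _ -> _); set G := (G in _ -> G @ _ --> _).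
suff -> : G = F by [].
by apply/funext => t; rewrite /F /G; apply: eq_bigr => i _; rewrite !addrA.
Qed.

Lemma continuous_translate u x h :
  {for x + h, continuous u} -> {for h, continuous (fun y => u (x + y))}.
Proof.
move=> cu; apply: (@continuous_comp _ _ _ (fun y => x + y) u) => //.
by apply: (@continuousD _ _ _ (fun=> x) id h); [exact: cst_continuous|move=> U].
Qed.

Lemma degree_lt_deg_lt (k : nat) (alpha : R) (p : mpoly n R) : alpha < 1 ->
  degree_lt (k%:R + alpha) p -> deg_lt k.+1 p.
Proof.
move=> al1 dp b kb; apply: memN_msupp_eq0; apply/negP => /dp.
apply/negP; rewrite -leNgt; apply: (@le_trans _ _ k.+1%:R); last by rewrite ler_nat.
by rewrite -natr1 lerD2l ltW.
Qed.

Lemma deg_lt_degree_lt (k : nat) (alpha : R) (p : mpoly n R) : 0 < alpha ->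
  deg_lt k.+3 p -> degree_lt (k%:R + alpha + 2) p.
Proof.
move=> al0 dp b; rewrite mcoeff_msupp => pb.
have : (mdeg b < k.+3)%N.
  by rewrite ltnNge; apply: contra pb => /dp ->.
rewrite ltnS -(ler_nat R) => /le_lt_trans; apply.
by rewrite -addn2 natrD; lra.
Qed.

(** Stated for every admissible L, with C independent of it, so that the infimum over L can be taken
    afterwards whether or not it is attained. For |x| < 1 - delta and |h| < delta, the point x + h
    stays in the unit ball, where the equation and the bound on u hold. *)
Lemma poisson_expansion (n_gt0 : (0 < n)%N) (k : nat) (alpha delta : R) :
  0 < alpha < 1 -> 0 < delta < 1 ->
  exists2 C : R, 0 < C & forall f u (L M : R), 0 <= M ->
    has_expansion_bound (k%:R + alpha) delta 1 f L ->
    (forall x, euclid_ball 1 x -> `|u x| <= M) ->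
    poisson_solution (euclid_ball 1) f u ->
    has_expansion_bound (k%:R + alpha + 2) delta (1 - delta) u (C * (L + M)).
Proof.
move=> al01 de01; have /andP[al0 al1] := al01; have /andP[de0 de1] := de01.
have [Cq Cq0 hCq] := poisson_polynomial R n_gt0 k.+1.
have [Cs Cs0 hCs] := pointwise_schauder n_gt0 k al01 de01.
pose N : R := #|{: bmultinom n k.+3}|%:R.
have N0 : 0 <= N by exact: ler0n.
have NC0 : 0 <= N * Cq by exact: mulr_ge0.
(* Cq L bounds the coefficients of Q and N Cq L its values on the unit ball; Cs multiplies the total
   M + N Cq L + L. The 1 makes the constant positive. *)
exists (1 + Cq + Cs * (2 + N * Cq)).
  by rewrite ltr_wpDr ?mulr_ge0 ?addr_ge0// ltr_wpDr.
move=> f u L M M0 [L0 fL] uM [u2 uf].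
set C := 1 + Cq + _.
have ML : 0 < L + M by rewrite ltr_wpDr.
have C1 : 1 <= C.
  by rewrite /C -addrA lerDl addr_ge0// mulr_ge0// addr_ge0.
split; first by rewrite mulr_gt0// (lt_le_trans _ C1).
move=> x xd.
have x1 : euclid_ball 1 x by apply: lt_trans xd _; lra.
have [p [degp coefp hp]] := fL x x1.
have [Q [degQ lapQ coefQ]] := hCq p L (degree_lt_deg_lt al1 degp) coefp.
have inB h : euclid_norm h < delta -> euclid_ball 1 (x + h).
  by move=> hd; apply: le_lt_trans (euclid_normD _ _) _; move: xd; rewrite /euclid_ball/=; lra.
have CqL0 : 0 <= Cq * L by rewrite mulr_ge0// ltW.
have Mv0 : 0 <= M + N * (Cq * L) by rewrite addr_ge0// mulr_ge0.
have hv h : euclid_norm h < delta ->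
    [/\ {for h, continuous (fun y => u (x + y) - ev Q y)},
        `|u (x + h) - ev Q h| <= M + N * (Cq * L) &
     exists2 l, `|l| <= L * euclid_norm h `^ (k%:R + alpha) &
       lap_at (fun y => u (x + y) - ev Q y) h l].
  move=> hd; have xh := inB h hd; split.
  - apply: continuousB; last exact: continuous_ev.
    apply: continuous_translate; apply: (C1_continuous u2.1).
    exact: open_nbhs_nbhs (conj (@open_euclid_ball R n 1) xh).
  - apply: le_trans (ler_normB _ _) (lerD (uM _ xh) _).
    by apply: ev_deg_lt_le => //; exact/ltW/(lt_trans hd).
  (* This is the Laplacian of the difference at h; the expansion of f at x is exactly the bound
     required of it. *)
  - exists (f (x + h) - ev p h); first exact: hp.
    apply: lap_atB.
      apply: lap_at_translate; rewrite -uf//.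
      exact: C2_lap_at (@open_euclid_ball R n 1) xh u2.
    by have := lap_at_poly Q h; rewrite lapQ.
have [p1 [degp1 coefp1 hp1]] := hCs _ _ L Mv0 L0 hv.
have bound : Cs * (M + N * (Cq * L) + L) + Cq * L <= C * (L + M).
  have t1 : 0 <= Cs * (1 * L + N * Cq * M + M).
    by rewrite mulr_ge0// addr_ge0// addr_ge0 ?mulr_ge0 ?(ltW L0).
  have t2 : 0 <= Cq * M by rewrite mulr_ge0.
  by rewrite /C; lra.
exists (Q + p1); split.
- by apply: deg_lt_degree_lt => //; exact: deg_ltD.
- move=> b; rewrite mcoeffD; apply: le_trans (ler_normD _ _) (le_trans _ bound).
  by rewrite addrC; exact: lerD.
- move=> h hd; rewrite mevalD opprD addrA; apply: le_trans (hp1 h hd) _.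
  by rewrite ler_wpM2r ?powR_ge0// (le_trans _ bound)// lerDl.
Qed.

Lemma C0_norm_ge (A : set 'rV[R]_n) u x : [bounded u y | y in A] -> A x ->
  `|u x| <= C0_norm A u.
Proof.
move=> bu Ax; apply: ub_le_sup; last by exists x.
near (pinfty_nbhs R) => K.
have uK : forall y, A y -> `|u y| <= K by near: K; exact: bu.
by exists K => _ [y Ay <-]; exact: uK.
Unshelve. all: by end_near. Qed.

End Main.

Unset Implicit Arguments.
Set Strict Implicit.

Theorem theorem3p1 (R : realType) (n : nat) (n_ge1 : (1 <= n)%N)
    (delta : R) (delta01 : 0 < delta < 1)
    (q : R) (k : nat) (alpha : R) (alpha01 : 0 < alpha < 1)
    (qE : q = k%:R + alpha) :
  exists C : R, forall f u : 'rV[R]_n -> R,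
    bounded_expansion q delta 1 f ->
    [bounded u x | x in euclid_ball (n:=n) (1 : R)] ->
    poisson_solution (euclid_ball 1) f u ->
    bounded_expansion (q + 2) delta (1 - delta) u /\
    expansion_norm (q + 2) delta (1 - delta) u
      <= C * (expansion_norm q delta 1 f + C0_norm (euclid_ball 1) u).
Proof.
have [C C_gt0 hC] := poisson_expansion n_ge1 k alpha01 delta01.
exists C => f u [L0 hL0] bu fu; rewrite {}qE in hL0 *.
have uM x : euclid_ball 1 x -> `|u x| <= C0_norm (euclid_ball 1) u.
  exact: C0_norm_ge.
have M0 : 0 <= C0_norm (euclid_ball 1) u.
  by apply: le_trans (uM 0 _) => //; rewrite /euclid_ball/= euclid_norm0.
split; first by exists (C * (L0 + C0_norm (euclid_ball 1) u)); exact: hC M0 hL0 uM fu.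
(* Solved for the norm of f, the inequality says that the norm of u divided by C, minus the supremum
   of |u|, is a lower bound of the constants admissible for f. *)
rewrite mulrC -ler_pdivrMr// -lerBlDr; apply: lb_le_inf; first by exists L0.
move=> L hL; rewrite lerBlDr ler_pdivrMr// mulrC.
apply: ge_inf; last exact: hC M0 hL uM fu.
(* Admissible constants are positive, so their infimum lies below each of them. *)
by exists 0 => K [/ltW].
Qed.
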